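(* Consider a network of $m$ interconnected roads containing at least one Entry Road and at least one Exit Road. For each $j=1,\dots,m$ let a speed law $v_j$ be given on road $j$ which is Lipschitz continuous and bounded, $v_j\in \mathbf{W}^{1,\infty}(\mathbb{R}^+;[0,V_j])$, weakly decreasing, and such that $v_j(\rho)=0$ for all $\rho\ge 1$. Assign to $n$ drivers routes $\mathcal{R}_1,\dots,\mathcal{R}_n$ such that no route contains the same road twice and the last road of each route is an Exit Road. Each driver $\alpha\in\{1,\dots,n\}$ is assigned an initial position $x^o_\alpha$ in the first road of the route $\mathcal{R}_\alpha$, and these initial positions satisfy: whenever two distinct drivers $\alpha',\alpha''$ are initially on the same road, $|x^o_{\alpha'}-x^o_{\alpha''}|\ge \ell$. Then the system of differential equations $\dot x_\alpha=\mathcal{V}_\alpha(t,x)$, $\alpha=1,\dots,n$, on the network (with the speeds $\mathcal{V}_\alpha$ defined in the context), with $x_\alpha(0)=x^o_\alpha$ and $r_\alpha(0)$ equal to the first road of $\mathcal{R}_\alpha$, admits a unique solution on the time interval $[0,+\infty[$. Moreover, at any time $t>0$, for all distinct $\alpha',\alpha''\in\{1,\dots,n\}$ with $r_{\alpha'}(t)=r_{\alpha''}(t)$ one has $|x_{\alpha'}(t)-x_{\alpha''}(t)|\ge\ell$.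
   Context: **Network.** There are $m$ roads, indexed by $j=1,\dots,m$; each is a real interval travelled in the increasing direction. Roads are of three types: Entry Roads, copies of $]-\infty,0[$, with the convention $L_j=0$; Middle Roads, intervals $[0,L_j[$ with $0<L_j<+\infty$; Exit Roads, copies of $[0,+\infty[$, with the convention $L_j=+\infty$. All vehicles have the same length $\ell>0$, with $\ell$ smaller than (negligible with respect to) $L_j$ for every Middle Road $j$. Every Entry or Middle Road ends (at $L_j$) in a junction, and every Middle or Exit Road begins (at $0$) at a junction. Each junction either has a single incoming road or has a single outgoing road. Road indices encode priority: if roads $j<j'$ end at the same junction, then drivers on $j$ have priority over drivers on $j'$. **Drivers.** There are $n$ drivers, $\alpha=1,\dots,n$. The route $\mathcal{R}_\alpha$ of driver $\alpha$ is a finite sequence of road indices, where each road of the sequence other than the last ends at the junction where the next one begins. At time $t$, driver $\alpha$ is on road $r_\alpha(t)$, one of the roads in $\mathcal{R}_\alpha$, at position $x_\alpha(t)$ in the interval representing that road. $\mathcal{N}_\alpha(j)$ denotes the road following $j$ in $\mathcal{R}_\alpha$. **Speeds.** For each road $j$, the constant $V_j\le V_{\max}$ is the maximal speed on road $j$, and $v_j$ is the speed law on road $j$, with values in $[0,V_j]$; $V_{\max}$ is an upper bound on the speed of all vehicles. Driver $\alpha$, on an Entry or Middle Road, is said to be *at the end of the road* if $x_\alpha(t)\in[L_{r_\alpha(t)}-\ell,\,L_{r_\alpha(t)}[$; on an Exit Road a driver is never at the end of the road. Fix $t$ and write $r=r_\alpha(t)$ and, if $r$ is not an Exit Road, $r'=\mathcal{N}_\alpha(r)$,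 and let $J$ be the set of indices of all roads ending at the junction where $r$ ends. Let $$A=\{\alpha' : r_{\alpha'}(t)=r,\ x_{\alpha'}(t)>x_\alpha(t)\},\qquad B=\{\alpha' : r_{\alpha'}(t)=r'\},$$ $$C=\bigcup_{j\in J,\ j<r}\{\alpha' : r_{\alpha'}(t)=j,\ x_{\alpha'}(t)\ge L_j-\ell\}.$$ The speed $\mathcal{V}_\alpha(t,x)\in[0,V_{\max}]$ of driver $\alpha$ is: 1. If $A\ne\emptyset$: $\mathcal{V}_\alpha=v_r\!\left(\frac{\ell}{p-x_\alpha}\right)$ with $p=\min\{x_{\alpha'}(t):\alpha'\in A\}$. 2. If $A=\emptyset$ and $\alpha$ is not at the end of the road: $\mathcal{V}_\alpha=V_r$. 3. If $A=\emptyset$, $\alpha$ is at the end of the road, and $r=\min J$ (this includes the case in which $r$ is the only road entering the junction): $\mathcal{V}_\alpha=V_r$ if $B=\emptyset$; and $\mathcal{V}_\alpha=v_r\!\left(\frac{\ell}{p+L_r-x_\alpha}\right)$ with $p=\min\{x_{\alpha'}(t):\alpha'\in B\}$ if $B\neq\emptyset$. 4. If $A=\emptyset$, $\alpha$ is at the end of the road, and $r>\min J$: $\mathcal{V}_\alpha=0$ if $C\ne\emptyset$; $\mathcal{V}_\alpha=V_r$ if $C=\emptyset$ and $B=\emptyset$; and $\mathcal{V}_\alpha=v_r\!\left(\frac{\ell}{p+L_r-x_\alpha}\right)$ with $p=\min\{x_{\alpha'}(t):\alpha'\in B\}$ if $C=\emptyset$ and $B\ne\emptyset$. **Solutions.**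 A solution on a time interval $I$ is a collection of maps $t\mapsto(r_\alpha(t),x_\alpha(t))$, $\alpha=1,\dots,n$, such that: each driver travels the roads of $\mathcal{R}_\alpha$ in order; while $\alpha$ is on a given road, $x_\alpha$ is Lipschitz continuous and $\dot x_\alpha(t)=\mathcal{V}_\alpha(t,x(t))$ for a.e. $t$; and when $x_\alpha$ reaches the end $L_j$ of a road $j$, the driver instantaneously passes to position $0$ of road $\mathcal{N}_\alpha(j)$ (so the total distance driven by each driver is a continuous function of time). *)

(* Defs.v *)
From HB Require Import structures.
From mathcomp Require Import all_boot all_order all_algebra.
From mathcomp Require Import all_classical all_reals all_analysis.

Set Implicit Arguments.
Unset Strict Implicit.
Unset Printing Implicit Defensive.

Import Order.TTheory GRing.Theory Num.Theory.
Import numFieldNormedType.Exports.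

Local Open Scope classical_set_scope.
Local Open Scope ring_scope.

Inductive road_kind (R : realType) : Type :=
  | Entry
  | Middle of R
  | Exit.
Arguments Entry {R}.
Arguments Exit {R}.

Definition is_entry (R : realType) (k : road_kind R) : bool :=
  if k is Entry then true else false.

Definition is_exit (R : realType) (k : road_kind R) : bool :=
  if k is Exit then true else false.

Definition kind_length (R : realType) (k : road_kind R) : \bar R :=
  match k with
  | Entry => 0%E
  | Middle L => L%:E
  | Exit => +oo%E
  end.

Definition kind_interval (R : realType) (k : road_kind R) : interval R :=
  match k with
  | Entry => `]-oo, 0[
  | Middle L => `[0, L[
  | Exit => `[0, +oo[
  end.

(* [begins j] (resp. [ends j]) is the junction where the road [j] begins
   (resp. ends), or [None] when there is no such junction.  The order of the
   indices of the roads is the order of priority. *)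
Record network (R : realType) (m : nat) : Type := Network {
  kind : 'I_m -> road_kind R ;
  junction : finType ;
  begins : 'I_m -> option junction ;
  ends : 'I_m -> option junction ;
  middle_length_gt0 : forall j L, kind j = Middle L -> 0 < L ;
  begins_None : forall j, (begins j == None) = is_entry (kind j) ;
  ends_None : forall j, (ends j == None) = is_exit (kind j) ;
  single_in_or_out : forall q : junction,
    #|[set j | ends j == Some q]%SET| = 1%N \/
    #|[set j | begins j == Some q]%SET| = 1%N
}.

Definition road_length (R : realType) (m : nat) (N : network R m) (j : 'I_m) :
  \bar R := kind_length (kind N j).

(* The length as a real number; on an Exit Road it is a dummy value, which is
   never used for the drivers of a valid route. *)
Definition road_end (R : realType) (m : nat) (N : network R m) (j : 'I_m) : R :=
  fine (road_length N j).

Definition road_interval (R : realType) (m : nat) (N : network R m) (j : 'I_m) :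
  interval R := kind_interval (kind N j).

Definition connects (R : realType) (m : nat) (N : network R m) (i j : 'I_m) :
  bool := (ends N i != None) && (ends N i == begins N j).

Definition valid_route (R : realType) (m : nat) (N : network R m)
  (s : seq 'I_m) : bool := sorted (connects N) s.

(* The road following [j] in the route [s]; the dummy value [j] is returned
   for the last road of [s]. *)
Definition next_road (m : nat) (s : seq 'I_m) (j : 'I_m) : 'I_m :=
  nth j s (index j s).+1.

(* [None] when [A] is empty; otherwise the minimum does not depend on the
   element of [A] that is picked. *)
Definition min_pos (R : realType) (n : nat) (x : 'I_n -> R) (A : {set 'I_n}) :
  option R :=
  if [pick b in A] is Some b then Some (x [arg min_(a < b in A) x a]%O)
  else None.

(* Since the length of an Exit Road is [+oo], a driver is never at its end. *)
Definition at_end (R : realType) (m : nat) (N : network R m) (l : R)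
  (j : 'I_m) (y : R) : bool :=
  (road_length N j - l%:E <= y%:E < road_length N j)%E.

(* The speed of the driver [a] when each driver [b] is at the position [x b] on
   the road [r b]. *)
Definition speed (R : realType) (m n : nat) (N : network R m) (l : R)
  (V : 'I_m -> R) (v : 'I_m -> R -> R) (route : 'I_n -> seq 'I_m)
  (r : 'I_n -> 'I_m) (x : 'I_n -> R) (a : 'I_n) : R :=
  let ra := r a in
  let ra' := next_road (route a) ra in
  let J := [set j | ends N j == ends N ra]%SET in
  let A := [set b | (r b == ra) && (x a < x b)]%SET in
  let B := [set b | r b == ra']%SET in
  let C := (\bigcup_(j in J | (j < ra)%N)
              [set b | (r b == j) && (road_end N j - l <= x b)])%SET in
  let follow_B :=
    if min_pos x B is Some p then v ra (l / (p + road_end N ra - x a))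
    else V ra in
  if min_pos x A is Some p then v ra (l / (p - x a))
  else if ~~ at_end N l ra (x a) then V ra
  else if [forall j in J, (ra <= j)%N] then follow_B
  else if C != finset.set0 then 0
  else follow_B.

(* The abscissa along the route [s], measured from the position 0 of its first
   road, of the position [y] on the road [j] of [s]. *)
Definition route_abscissa (R : realType) (m : nat) (N : network R m)
  (s : seq 'I_m) (j : 'I_m) (y : R) : R :=
  \sum_(i <- take (index j s) s) road_end N i + y.

(* The derivative is a two-sided one, which makes no difference almost
   everywhere; the values of [r] and [x] outside of [I] are irrelevant. *)
Record solution (R : realType) (m n : nat) (N : network R m) (l : R)
  (V : 'I_m -> R) (v : 'I_m -> R -> R) (route : 'I_n -> seq 'I_m)
  (I : interval R) (r : 'I_n -> R -> 'I_m) (x : 'I_n -> R -> R) : Prop :=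
Solution {
  sol_road : forall a t, t \in I -> r a t \in route a ;
  sol_interval : forall a t, t \in I -> x a t \in road_interval N (r a t) ;
  sol_order : forall a s t, s \in I -> t \in I -> s <= t ->
    (index (r a s) (route a) <= index (r a t) (route a))%N ;
  sol_lipschitz : forall a j,
    [lipschitz x a t | t in [set t | t \in I /\ r a t = j]] ;
  sol_ode : forall a, {ae @lebesgue_measure R, forall t, t \in I ->
    is_derive t (1 : R) (x a) (speed N l V v route (r^~ t) (x^~ t) a)} ;
  sol_pass : forall a j L s t, road_length N j = L%:E ->
    s \in I -> t \in I -> s < t ->
    (forall u, s <= u < t -> r a u = j) ->
    x a u @[u --> t^'-] --> L ->
    r a t = next_road (route a) j /\ x a t = 0 ;
  sol_continuous : forall a, {within [set` I],
    continuous (fun t => route_abscissa N (route a) (r a t) (x a t))}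
}.

(* The law is only constrained on [0, +oo[. *)
Record speed_law (R : realType) (V : R) (v : R -> R) : Prop := SpeedLaw {
  speed_law_range : forall rho : R, 0 <= rho -> 0 <= v rho <= V ;
  speed_law_lipschitz : [lipschitz v rho | rho in `[0, +oo[] ;
  speed_law_decreasing : forall rho1 rho2 : R, 0 <= rho1 -> rho1 <= rho2 ->
    v rho2 <= v rho1 ;
  speed_law_eq0 : forall rho : R, 1 <= rho -> v rho = 0
}.

(* Main.v *)
(* Measure the position of each driver by its abscissa along its route.  The
   abscissas [X] are continuous and nondecreasing, they determine the roads and
   the positions, and they solve a system [X' = F X] almost everywhere, where [F]
   is discontinuous.

   Spacing.  A driver stops when the car in front is at a distance at most [l],
   so a gap of [l] persists on a road.  A driver who is about to enter a road
   has a positive speed at times arbitrarily close to the entrance; at these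
   times nobody with priority is at the end of a road, and the cars on the next
   road are more than [l] away.  Hence two drivers never enter a road together,
   and they are spaced when the second one enters.

   Well-posedness.  As abscissas only increase, leaders and rights of way do not
   change during a short time after a spaced configuration [X]: on the set
   [X <= Y < X + e] the field [F] coincides with a bounded Lipschitz field.
   Picard iteration gives a local solution to the right, and a contraction
   estimate gives uniqueness, first to the right and then everywhere by real
   induction.  Bounded speeds allow a solution to be continued up to the end of
   its interval, hence beyond it. *)
Require Import Defs.
From HB Require Import structures.
From mathcomp Require Import all_boot all_order all_algebra.
From mathcomp Require Import all_classical all_reals all_analysis.
From mathcomp Require Import lra.

Set Implicit Arguments.
Unset Strict Implicit.
Unset Printing Implicit Defensive.

Import Order.TTheory GRing.Theory Num.Theory.
Import numFieldNormedType.Exports.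

Local Open Scope classical_set_scope.
Local Open Scope ring_scope.

(** * Almost everywhere derivatives *)

(** Slopes known almost everywhere are never integrated. They are used through a mean value
    inequality: bounds on almost all slopes bound the increment. It is applied to single abscissas,
    to gaps between two drivers, and to differences of two solutions or of two Picard iterates.
    Spacing has to be proved for every solution before uniqueness: two cars at the same place could
    separate in either order, so the leaders would not be determined. It is an induction along the
    routes, because two drivers who would enter a road together from the same previous road are
    excluded only by their spacing on that previous road. The neighbourhoods on which the field is
    regular are one-sided, since a driver at the very start of a road was on another road just
    before. Hence every argument advances to the right, and the bound on the speeds is what passes
    to limits from the left. Denominators such as [Vmax + 1] or [K + 1] only guard against a
    vanishing bound. *)

Lemma real_induction (R : realType) (a b : R) (P : R -> Prop) :
  (forall x, a <= x <= b -> (forall y, a <= y < x -> P y) -> P x) ->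
  (forall x, a <= x < b -> (forall y, a <= y <= x -> P y) ->
    exists2 d, 0 < d & forall y, x < y < x + d -> P y) ->
  forall x, a <= x <= b -> P x.
Proof.
move=> Pl Pr x xab; apply: contrapT => nPx.
pose Z := [set y | a <= y <= b /\ ~ P y].
have Zx : Z x by [].
have lbZ : lbound Z a by move=> y [/andP[]].
have infZ : has_inf Z by split; [exists x|exists a].
have s_le y : Z y -> inf Z <= y by move=> Zy; apply: ge_inf => //; exists a.
have a_le : a <= inf Z by apply: lb_le_inf => //; exists x.
have Plt y : a <= y < inf Z -> P y.
  move=> /andP[ay ys]; apply: contrapT => nPy.
  have : inf Z <= y.
    apply: (s_le); split => //; rewrite ay /=.
    by have := s_le _ Zx; case/andP: xab; lra.
  by rewrite leNgt ys.
have sb : inf Z <= b by apply: le_trans (s_le _ Zx) _; case/andP: xab.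
have Ps : P (inf Z) by apply: Pl => //; rewrite a_le sb.
have Ple y : a <= y <= inf Z -> P y.
  move=> /andP[ay]; rewrite le_eqVlt => /predU1P[->//|ys].
  by apply: Plt; rewrite ay.
have [sltb|bs] := ltP (inf Z) b; last first.
  apply: nPx; apply: Ple; case/andP: xab => -> xb /=.
  exact: le_trans xb bs.
have [|d d0 Pd] := Pr (inf Z) _ Ple; first by rewrite a_le.
have : inf Z + d <= inf Z.
  apply: lb_le_inf; first by exists x.
  move=> z Zz; rewrite leNgt; apply/negP => zlt.
  have := s_le _ Zz; rewrite le_eqVlt => /predU1P[sz|sz].
    by case: Zz => _; apply; rewrite -sz.
  by case: Zz => _; apply; apply: Pd; rewrite sz.
by lra.
Qed.

(** The first-order expansion is kept free of divisions, so that increments are compared by linear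
    arithmetic, also at [u = t]. *)
Definition has_slope (R : realType) (f : R -> R) (t d : R) :=
  forall e, 0 < e -> exists2 h, 0 < h & forall u, `|u - t| < h ->
    `|f u - f t - d * (u - t)| <= e * `|u - t|.

Lemma has_slopeP (R : realType) (f : R -> R) (t d : R) :
  has_slope f t d <-> is_derive t (1 : R) f d.
Proof.
have slope_cvg : has_slope f t d <->
    (fun h => h^-1 *: ((f \o shift t) (h *: (1 : R)) - f t)) @ 0^' --> d.
  have nE h : h != 0 ->
      `|d - h^-1 *: ((f \o shift t) (h *: (1 : R)) - f t)| =
      `|f (t + h) - f t - d * h| / `|h|.
    move=> h0; rewrite /= distrC -normf_div; congr `|_|.
    rewrite /shift /= [h *: _]mulr1 /GRing.scale /= [t + h]addrC.
    by rewrite [RHS]mulrBl mulfK // mulrC.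
  split=> [fd|/cvgrPdist_le fd e e0].
    apply/cvgrPdist_le => e /fd[h h0 fh].
    exists h => //= u /= uh u0; rewrite nE // ler_pdivrMr ?normr_gt0 //.
    have := fh (t + u); rewrite addrAC subrr add0r; apply.
    by move: uh; rewrite sub0r normrN.
  have [h /= h0 fh] := fd e e0.
  exists h => // u uh; have [->|ut] := eqVneq u t.
    by rewrite !subrr mulr0 subr0 normr0 mulr0.
  have u0 : u - t != 0 by rewrite subr_eq0.
  have := fh (u - t); rewrite /= sub0r normrN => /(_ uh u0).
  by rewrite nE // ler_pdivrMr ?normr_gt0 // [t + _]addrC subrK.
split=> [/slope_cvg fd|[fd fE]].
  by split; [apply/cvg_ex; exists d|exact: cvg_lim].
by apply/slope_cvg; rewrite -fE.
Qed.

Lemma itv_nbhs (R : realType) (P : set R) (t : R) :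
  nbhs t P <-> exists2 h, 0 < h & forall u, `|u - t| < h -> P u.
Proof.
split=> [/nbhs_ballP[h /= h0 hP]|[h h0 hP]].
  by exists h => // u ut; apply: hP; rewrite /ball /= distrC.
by apply/nbhs_ballP; exists h => // u; rewrite /ball /= distrC; exact: hP.
Qed.

Section almost_everywhere_monotone.
Variable R : realType.
Local Notation mu := (@lebesgue_measure R).

(* The bad set is covered by an open set [U] of small measure; adding a
   multiple of the measure of [U] to the left of the current point compensates
   for the decrease of [f] there. *)
Lemma ae_slope_ge0_le (f : R -> R) (a b K : R) : a <= b -> 0 <= K ->
  (forall x, a < x <= b -> forall e, 0 < e -> exists2 h, 0 < h &
    forall u, x - h < u < x -> a <= u -> f u - f x <= e) ->
  (forall x, a <= x < b -> exists2 h, 0 < h &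
    forall u, x < u < x + h -> f x - K * (u - x) <= f u) ->
  {ae mu, forall t, a < t < b -> exists2 d, 0 <= d & has_slope f t d} ->
  f a <= f b.
Proof.
move=> ab K0 fl fr [E [mE E0 nE]].
suff fab e : 0 < e -> f a <= f b + e * (b - a) + K * e.
  apply/ler_addgt0Pr => e e0.
  have D0 : 0 < b - a + K + 1 by lra.
  have := fab (e / (b - a + K + 1)) (divr_gt0 e0 D0).
  suff : e / (b - a + K + 1) * (b - a) + K * (e / (b - a + K + 1)) <= e by lra.
  rewrite [K * _]mulrC -mulrDr mulrAC ler_pdivrMr //.
  by apply: ler_pM => //; lra.
move=> e0.
(* Slopes are known only strictly between [a] and [b], so the endpoint [a] is counted among the bad
   points. *)
have ma : measurable [set a] by exact: measurable_set1.
have mua : mu [set a] = 0%E by exact: lebesgue_measure_set1.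
have mEa : mu (E `|` [set a]) = 0%E by rewrite measureU0.
have mEa_fin : (mu (E `|` [set a]) < +oo)%E by rewrite mEa.
have [||U [oU EU Ue]] := @lebesgue_regularity_outer R (E `|` [set a]) e _ _ e0.
- exact: measurableU.
- exact: mEa_fin.
have mU : measurable U by exact: measurable_realfun.open_measurable.
have Ule : (mu U <= e%:E)%E.
  have -> : U = (U `\` (E `|` [set a])) `|` (E `|` [set a]).
    by rewrite setUC setDUK.
  rewrite measureU0 //; first exact: ltW.
  - by apply: measurableD => //; exact: measurableU.
  - exact: measurableU.
have mu_le (A B : set R) : measurable A -> measurable B -> A `<=` B ->
    (mu A <= mu B)%E.
  by have := @le_measure _ _ _ mu A B; rewrite !inE; exact.
pose G x := (mu (U `&` `[a, x]))%E.
have mG x : measurable (U `&` `[a, x]) by exact: measurableI.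
have Gle x : (G x <= e%:E)%E.
  by apply: le_trans Ule; apply: mu_le => // z [].
have Gfin x : G x \is a fin_num.
  by rewrite ge0_fin_numE //; apply: le_lt_trans (Gle x) (ltry _).
pose g x := fine (G x).
have gG x : G x = (g x)%:E by rewrite fineK.
have g_mono x y : x <= y -> g x <= g y.
  move=> xy; rewrite -lee_fin -!gG; apply: mu_le => //.
  apply: setIS => z /=; rewrite !in_itv /= => /andP[-> zx].
  exact: le_trans xy.
have g_le x : g x <= e by rewrite -lee_fin -gG.
have g_ge0 x : 0 <= g x by rewrite -lee_fin -gG measure_ge0.
have g_step x y : a <= x -> x < y -> (forall z, x < z <= y -> U z) ->
    g x + (y - x) <= g y.
  move=> ax xy Uxy; rewrite -lee_fin EFinD -!gG.
  have <- : mu `]x, y] = (y - x)%:E.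
    by rewrite lebesgue_measure_itv /= lte_fin xy.
  have <- : mu ((U `&` `[a, x]) `|` `]x, y]) = (mu (U `&` `[a, x]) + mu `]x, y])%E.
    apply: measureU => //; first exact: mG.
    apply/seteqP; split => // z [[_]] /=; rewrite !in_itv /= => /andP[_ zx].
    by move=> /andP[]; rewrite ltNge zx.
  apply: (mu_le); [exact: measurableU|exact: mG|].
  move=> z zxy; have [Uz] : U z /\ (a <= z <= y).
    case: zxy => [[Uz]|]; rewrite /mkset /= ?in_itv /= => /andP[az zx].
      by split => //; rewrite az; lra.
    by split; [apply: Uxy; rewrite az|rewrite zx andbT; lra].
  by split => //; rewrite /= in_itv.
suff /(_ b) : forall x, a <= x <= b -> f a <= f x + e * (x - a) + K * g x.
  rewrite ab lexx => /(_ isT) fab; apply: le_trans fab _.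
  by rewrite lerD2l ler_wpM2l.
apply: real_induction => x /andP[ax xb].
- move=> Px; move: ax; rewrite le_eqVlt => /predU1P[<-|ax].
    by rewrite subrr mulr0 addr0 lerDl mulr_ge0.
  apply/ler_addgt0Pr => e' /(fl x); rewrite ax xb => /(_ isT)[h h0 fh].
  pose u := Num.max a (x - h / 2).
  have au : a <= u by rewrite le_max lexx.
  have ux : u < x by rewrite gt_max ax; lra.
  have := fh u; rewrite ux lt_max => /(_ _ au).
  have -> : x - h < x - h / 2 by lra.
  rewrite orbT => /(_ isT) fux.
  have := Px u; rewrite au ux => /(_ isT) fu.
  have gu : K * g u <= K * g x by rewrite ler_wpM2l // g_mono // ltW.
  have eu : e * (u - a) <= e * (x - a) by rewrite ler_wpM2l; lra.
  lra.
- move=> /(_ x); rewrite ax lexx => /(_ isT) Px.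
  have [h h0 fh] : exists2 h, 0 < h & forall u, x < u < x + h ->
      f x - e * (u - x) - K * (g u - g x) <= f u; last first.
    by exists h => // u /fh; lra.
  have [xE|xE] := pselect ((E `|` [set a]) x).
    have /itv_nbhs[h h0 Uh] : nbhs x U.
      by apply: open_nbhs_nbhs; split => //; exact: EU.
    have [|h' h'0 fh'] := fr x; first by rewrite ax.
    exists (Num.min h h'); first by rewrite lt_min h0.
    move=> u /andP[xu uh].
    have [uh1 uh2] : u < x + h /\ u < x + h'.
      have : u - x < Num.min h h' by lra.
      by rewrite lt_min => /andP[]; split; lra.
    have := fh' u; rewrite xu uh2 => /(_ isT).
    have : K * (u - x) <= K * (g u - g x).
      rewrite ler_wpM2l // lerBrDl g_step // => z /andP[xz zu].
      by apply: Uh; rewrite ger0_norm; lra.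
    have : 0 <= e * (u - x) by rewrite mulr_ge0; lra.
    by lra.
  have xa : a < x.
    rewrite lt_neqAle ax andbT; apply/eqP => xa; apply: xE; right.
    by rewrite /= xa.
  have /contrapT : ~ ~ (a < x < b -> exists2 d, 0 <= d & has_slope f x d).
    by move=> nfx; apply: xE; left; apply: nE.
  rewrite xa xb => /(_ isT)[d d0 /(_ e e0)[h h0 fh]].
  exists h => // u /andP[xu uh].
  have := fh u; rewrite gtr0_norm ?subr_gt0 // => /(_ _)/ler_normlP[|fu _].
    by lra.
  have : 0 <= d * (u - x) by rewrite mulr_ge0; lra.
  have : 0 <= K * (g u - g x).
    by rewrite mulr_ge0 // subr_ge0 g_mono // ltW.
  by lra.
Qed.

End almost_everywhere_monotone.

Lemma ae_imply (R : realType) (P Q : R -> Prop) : (forall t, P t -> Q t) ->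
  {ae @lebesgue_measure R, forall t, P t} -> {ae @lebesgue_measure R, forall t, Q t}.
Proof. move=> PQ; apply: negligibleS => t /= nQ /PQ. exact: nQ. Qed.

Lemma ae_imply2 (R : realType) (P Q S : R -> Prop) : (forall t, P t -> Q t -> S t) ->
  {ae @lebesgue_measure R, forall t, P t} -> {ae @lebesgue_measure R, forall t, Q t} ->
  {ae @lebesgue_measure R, forall t, S t}.
Proof.
move=> PQS Pae Qae; have := negligibleU Pae Qae.
apply: negligibleS => t /= nS; have [Pt|nP] := pselect (P t); [right|by left].
by move=> Qt; apply: nS; exact: PQS Pt Qt.
Qed.

Lemma ae_forall_nat (R : realType) (P : nat -> R -> Prop) :
  (forall i, {ae @lebesgue_measure R, forall t, P i t}) ->
  {ae @lebesgue_measure R, forall t, forall i, P i t}.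
Proof.
move=> /(negligible_bigcup (mu := @lebesgue_measure R)).
apply: negligibleS => t /= /existsNP[i nPi].
by exists i.
Qed.

Lemma ae_forall_fin (R : realType) (I : finType) (P : I -> R -> Prop) :
  (forall i, {ae @lebesgue_measure R, forall t, P i t}) ->
  {ae @lebesgue_measure R, forall t, forall i, P i t}.
Proof.
move=> Pae; pose Q k t := forall i, enum_rank i = k :> nat -> P i t.
have /ae_forall_nat : forall k, {ae @lebesgue_measure R, forall t, Q k t}.
  move=> k; have [[i ik]|nk] := pselect (exists i : I, enum_rank i = k :> nat).
    apply: ae_imply (Pae i) => t Pit i'; rewrite -ik => /ord_inj/enum_rank_inj ->.
    exact: Pit.
  apply: aeW => t i ik; exfalso; apply: nk; by exists i.
by apply: ae_imply => t Qt i; exact: Qt.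
Qed.

Lemma ae_notin_set1 (R : realType) (c : R) : {ae @lebesgue_measure R, forall t, t != c}.
Proof.
exists [set c]; split; [exact: measurable_set1|exact: lebesgue_measure_set1|].
by move=> t /= /negP; rewrite negbK => /eqP.
Qed.

Lemma has_slope_cst_mul (R : realType) (c t : R) : has_slope (fun u => c * u) t c.
Proof.
move=> e e0; exists 1 => // u _.
by rewrite -mulrBr subrr normr0 mulr_ge0 // ltW.
Qed.

Lemma has_slopeB (R : realType) (f g : R -> R) (t d d' : R) :
  has_slope f t d -> has_slope g t d' ->
  has_slope (fun u => f u - g u) t (d - d').
Proof.
move=> fd gd e e0; have e20 : 0 < e / 2 by lra.
have [h h0 fh] := fd _ e20; have [k k0 gk] := gd _ e20.
exists (Num.min h k); first by rewrite lt_min h0.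
move=> u; rewrite lt_min => /andP[/fh {}fh /gk {}gk].
have -> : f u - g u - (f t - g t) - (d - d') * (u - t) =
  (f u - f t - d * (u - t)) - (g u - g t - d' * (u - t)) by lra.
by apply: le_trans (ler_normB _ _) _; lra.
Qed.

Lemma near_has_slope (R : realType) (f g : R -> R) (t d k : R) : 0 < k ->
  (forall u, `|u - t| < k -> f u - f t = g u - g t) ->
  has_slope f t d -> has_slope g t d.
Proof.
move=> k0 fg fd e /fd[h h0 fh]; exists (Num.min h k); first by rewrite lt_min h0.
by move=> u; rewrite lt_min => /andP[/fh {}fh /fg <-].
Qed.

(** Left continuity and a right-hand Lipschitz bound are separate hypotheses because of the
    abscissas of a given solution: just after any time the road is constant and the position is
    Lipschitz on it, but just before, the road may be another one and only continuity is
    available. *)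
Lemma ae_slope_bounds (R : realType) (f : R -> R) (a b K c c' : R) :
  a <= b -> 0 <= K ->
  (forall x, a < x <= b -> forall e, 0 < e -> exists2 h, 0 < h &
    forall u, x - h < u < x -> a <= u -> `|f u - f x| <= e) ->
  (forall x, a <= x < b -> exists2 h, 0 < h &
    forall u, x < u < x + h -> `|f u - f x| <= K * (u - x)) ->
  {ae @lebesgue_measure R, forall t, a < t < b ->
    exists2 d, c <= d <= c' & has_slope f t d} ->
  c * (b - a) <= f b - f a <= c' * (b - a).
Proof.
move=> ab K0 fl fr fs.
have lin_le (k x u : R) : x < u -> `|k * u - k * x| <= `|k| * (u - x).
  by move=> xu; rewrite -mulrBr normrM (gtr0_norm (_ : 0 < u - x)) // subr_gt0.
have lin_left (k e : R) : 0 < e -> exists2 h, 0 < h &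
    forall x u : R, x - h < u < x -> `|k * u - k * x| <= e.
  move=> e0; have D0 : 0 < `|k| + 1 by rewrite ltr_wpDl.
  exists (e / (`|k| + 1)); first exact: divr_gt0.
  move=> x u /andP[xu ux]; rewrite distrC; apply: le_trans (lin_le k u x ux) _.
  have : (x - u) * (`|k| + 1) <= e by rewrite -ler_pdivlMr //; lra.
  have : 0 <= x - u by lra.
  by lra.
apply/andP; split.
- suff : f a - c * a <= f b - c * b by lra.
  apply: (@ae_slope_ge0_le _ (fun u => f u - c * u) _ _ (K + `|c|)) => //.
  + by rewrite addr_ge0.
  + move=> x xab e e0; have e20 : 0 < e / 2 by lra.
    have [h h0 fh] := fl x xab _ e20; have [k k0 ck] := lin_left c _ e20.
    exists (Num.min h k); first by rewrite lt_min h0.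
    move=> u /andP[xu ux] au; have : x - u < Num.min h k by lra.
    rewrite lt_min => /andP[xh xk].
    have xhu : x - h < u < x by apply/andP; split; lra.
    have xku : x - k < u < x by apply/andP; split; lra.
    have /ler_normlP[_] := fh u xhu au.
    have /ler_normlP[] := ck x u xku.
    by lra.
  + move=> x /fr[h h0 fh]; exists h => // u xu.
    have /ler_normlP[+ _] := fh u xu; case/andP: xu => xu _.
    by have /ler_normlP[_] := lin_le c x u xu; lra.
  + apply: ae_imply fs => t ft /ft[d /andP[cd _] fd].
    exists (d - c); first by lra.
    exact: has_slopeB fd (has_slope_cst_mul c t).
- suff : c' * a - f a <= c' * b - f b by lra.
  apply: (@ae_slope_ge0_le _ (fun u => c' * u - f u) _ _ (K + `|c'|)) => //.
  + by rewrite addr_ge0.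
  + move=> x xab e e0; have e20 : 0 < e / 2 by lra.
    have [h h0 fh] := fl x xab _ e20; have [k k0 ck] := lin_left c' _ e20.
    exists (Num.min h k); first by rewrite lt_min h0.
    move=> u /andP[xu ux] au; have : x - u < Num.min h k by lra.
    rewrite lt_min => /andP[xh xk].
    have xhu : x - h < u < x by apply/andP; split; lra.
    have xku : x - k < u < x by apply/andP; split; lra.
    have /ler_normlP[+ _] := fh u xhu au.
    have /ler_normlP[_] := ck x u xku.
    by lra.
  + move=> x /fr[h h0 fh]; exists h => // u xu.
    have /ler_normlP[_] := fh u xu; case/andP: xu => xu _.
    by have /ler_normlP[+ _] := lin_le c' x u xu; lra.
  + apply: ae_imply fs => t ft /ft[d /andP[_ cd] fd].
    exists (c' - d); first by lra.
    exact: has_slopeB (has_slope_cst_mul c' t) fd.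
Qed.

Lemma lipschitz_ae_slope_bounds (R : realType) (f : R -> R) (a b K c c' : R) :
  a <= b ->
  (forall s t, a <= s -> s <= t -> t <= b -> `|f t - f s| <= K * (t - s)) ->
  {ae @lebesgue_measure R, forall t, a < t < b ->
    exists2 d, c <= d <= c' & has_slope f t d} ->
  c * (b - a) <= f b - f a <= c' * (b - a).
Proof.
move=> ab fK; have K'0 : 0 <= Num.max K 0 by rewrite le_max lexx orbT.
have {}fK s t : a <= s -> s <= t -> t <= b ->
    `|f t - f s| <= Num.max K 0 * (t - s).
  move=> sa st tb; apply: le_trans (fK _ _ sa st tb) _.
  by rewrite ler_wpM2r ?subr_ge0 // le_max lexx.
apply: (ae_slope_bounds (K := Num.max K 0)) => // x /andP[ax xb].
- move=> e e0; have D0 : 0 < Num.max K 0 + 1 by lra.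
  exists (e / (Num.max K 0 + 1)); first exact: divr_gt0.
  move=> u /andP[xu ux] au; rewrite distrC.
  apply: le_trans (fK _ _ au (ltW ux) xb) _.
  have : (x - u) * (Num.max K 0 + 1) <= e by rewrite -ler_pdivlMr //; lra.
  by lra.
- exists (b - x); first by rewrite subr_gt0.
  by move=> u /andP[xu ub]; apply: fK => //; lra.
Qed.

(** * Speeds *)

Lemma lipschitz_bound (R : realType) (f : R -> R) (A : set R) :
  [lipschitz f x | x in A] <-> exists2 K, 0 <= K &
    forall x y, A x -> A y -> `|f x - f y| <= K * `|x - y|.
Proof.
split=> [[M [Mreal MP]]|[K K0 fK]].
  exists (`|M| + 1) => [|x y Ax Ay]; first by rewrite addr_ge0.
  have := MP (`|M| + 1); rewrite ltr_pwDr ?ler_norm // => /(_ isT (x, y)).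
  by apply; split.
exists K; split => [|M KM]; first exact: ger0_real.
move=> [x y] /= [Ax Ay]; apply: le_trans (fK _ _ Ax Ay) _.
by rewrite ler_wpM2r // ltW.
Qed.

(** Turns finitely many strict inequalities into one margin; the value [1] covers the case where
    none of them is strict. *)
Lemma pos_lower_bound (R : realType) (I : finType) (h : I -> R) :
  exists2 e, 0 < e & forall i, 0 < h i -> e <= h i.
Proof.
exists (\big[Num.min/1]_(i | 0 < h i) h i); first exact: lt_bigmin.
by move=> i hi; exact: bigmin_le_cond.
Qed.

Lemma min_posP (R : realType) (n : nat) (x : 'I_n -> R) (A : {set 'I_n}) :
  if min_pos x A is Some p then
    exists2 b, b \in A & p = x b /\ forall c, c \in A -> p <= x c
  else A = finset.set0.
Proof.
rewrite /min_pos; case: pickP => [b bA|A0].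
  by case: Order.TotalTheory.arg_minP => //= c cA cmin; exists c.
by apply/setP => b; rewrite A0 finset.in_set0.
Qed.

(** A minimum over a fixed set is 1-Lipschitz for the uniform distance. This fails when the set
    moves with the positions, which is why the leaders get frozen. *)
Lemma min_pos_close (R : realType) (n : nat) (x y : 'I_n -> R) (A : {set 'I_n})
    (p q d : R) :
  (forall b, `|x b - y b| <= d) -> min_pos x A = Some p -> min_pos y A = Some q ->
  `|p - q| <= d.
Proof.
move=> xy; have := min_posP x A; have := min_posP y A.
move=> + + px qy; rewrite px qy => -[b bA [-> bmin]] [c cA [-> cmin]].
have /ler_normlP[_ xyb] := xy b; have /ler_normlP[xyc _] := xy c.
have := bmin _ cA; have := cmin _ bA.
by move=> ? ?; apply/ler_normlP; split; lra.
Qed.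

Lemma min_pos_None (R : realType) (n : nat) (x y : 'I_n -> R) (A : {set 'I_n}) :
  min_pos x A = None -> min_pos y A = None.
Proof.
have := min_posP x A; have := min_posP y A.
case: (min_pos x A) => // + A0; rewrite A0.
by case: (min_pos y _) => // p [b]; rewrite finset.in_set0.
Qed.

(* The speed law as a function of the distance to the car in front.  As the law
   vanishes from the density 1 on, cutting the distance off at the length of a
   car changes nothing, and makes the dependence Lipschitz. *)
Section gap_speed.
Variables (R : realType) (m : nat) (l : R) (V : 'I_m -> R) (v : 'I_m -> R -> R).
Hypothesis l_gt0 : 0 < l.
Hypothesis v_law : forall j, speed_law (V j) (v j).

Definition gap_speed (j : 'I_m) (g : R) : R := v j (l / Num.max g l).

Lemma gap_speedE j g : 0 < g -> v j (l / g) = gap_speed j g.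
Proof.
move=> g0; rewrite /gap_speed; case: (leP l g) => // gl.
have v0 := speed_law_eq0 (v_law j).
rewrite !v0 // ?ler_pdivlMr // ?mul1r // ?ltW //.
Qed.

Let max_gt0 g : 0 < Num.max g l. Proof. by rewrite lt_max l_gt0 orbT. Qed.

Lemma gap_speed_range j g : 0 <= gap_speed j g <= V j.
Proof.
apply: (speed_law_range (v_law j)).
by apply: divr_ge0; [exact: ltW|exact/ltW/max_gt0].
Qed.

Lemma gap_speed_eq0 j g : g <= l -> gap_speed j g = 0.
Proof.
by move=> gl; rewrite /gap_speed max_r // (speed_law_eq0 (v_law j)) // divff // gt_eqF.
Qed.

Lemma gap_speed_lipschitz : exists2 K, 0 <= K &
  forall j g g', `|gap_speed j g - gap_speed j g'| <= K * `|g - g'|.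
Proof.
have /choice[K KP] : forall j, exists K, 0 <= K /\
    forall g g', `|gap_speed j g - gap_speed j g'| <= K * `|g - g'|.
  move=> j; have /lipschitz_bound[K K0 Kv] := speed_law_lipschitz (v_law j).
  (* The cut-off is 1-Lipschitz, and [l / z] has Lipschitz constant [1 / l] on [z >= l]. *)
  exists (K / l); split; first by apply: divr_ge0 => //; exact: ltW.
  move=> g g'; set M := Num.max g l; set M' := Num.max g' l.
  have M0 : 0 < M by exact: max_gt0.
  have M'0 : 0 < M' by exact: max_gt0.
  have lM : l <= M by rewrite le_max lexx orbT.
  have lM' : l <= M' by rewrite le_max lexx orbT.
  have MM' : `|M - M'| <= `|g - g'|.
    rewrite /M /M'; case: (leP g l); case: (leP g' l) => ? ?.
    - by rewrite subrr normr0.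
    - by apply/ler_normlP; have /ler_normlP[] := lexx `|g - g'|; split; lra.
    - by apply/ler_normlP; have /ler_normlP[] := lexx `|g - g'|; split; lra.
    - by [].
  have vr (z : R) : 0 < z -> 0 <= l / z by move=> z0; rewrite divr_ge0 // ltW.
  apply: le_trans (Kv _ _ _ _) _; rewrite /= ?in_itv /= ?andbT ?vr //.
  rewrite -mulrA ler_wpM2l //.
  have -> : l / M - l / M' = l * (M' - M) / (M * M').
    rewrite mulrBr mulrBl invfM; congr (_ - _).
      by rewrite -!mulrA; congr (_ * _); rewrite mulrCA divff ?mulr1 // gt_eqF.
    rewrite [M^-1 * _]mulrC -!mulrA; congr (_ * _).
    by rewrite mulrCA divff ?mulr1 // gt_eqF.
  rewrite normrM normfV (gtr0_norm (mulr_gt0 M0 M'0)) normrM (gtr0_norm l_gt0).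
  rewrite distrC ler_pdivrMr ?mulr_gt0 // -mulrA [leRHS]mulrC ler_pdivlMr //.
  rewrite mulrAC mulrC.
  by apply: ler_pM => //; [by rewrite mulr_ge0 // ltW|apply: ler_pM => //; exact: ltW].
exists (\sum_j K j); first by apply: sumr_ge0 => j _; case: (KP j).
move=> j g g'; have [K0 Kg] := KP j; apply: le_trans (Kg g g') _.
rewrite ler_wpM2r // (bigD1 j) //= lerDl; apply: sumr_ge0 => i _.
by case: (KP i).
Qed.

End gap_speed.

Section network_facts.
Variables (R : realType) (m : nat) (N : network R m) (l : R).

Lemma road_lengthE j : ~~ is_exit (kind N j) -> road_length N j = (road_end N j)%:E.
Proof. by rewrite /road_end /road_length; case: (kind N j). Qed.

Lemma at_endE j y : at_end N l j y =
  ~~ is_exit (kind N j) && (road_end N j - l <= y < road_end N j).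
Proof.
have [ej|nej] := boolP (is_exit (kind N j)); last first.
  by rewrite /at_end road_lengthE // -EFinB lee_fin lte_fin.
by apply/negbTE; move: ej; rewrite /at_end /road_length; case: (kind N j) => //=.
Qed.

Lemma road_intervalE j y : y \in road_interval N j =
  (is_entry (kind N j) || (0 <= y)) && (is_exit (kind N j) || (y < road_end N j)).
Proof.
rewrite /road_interval /road_end /road_length.
by case: (kind N j) => [|L|] //=; rewrite in_itv //= ?andbT.
Qed.

Lemma connects_not_exit i j : connects N i j -> ~~ is_exit (kind N i).
Proof. by move=> /andP[+ _]; rewrite -ends_None. Qed.

Lemma connects_not_entry i j : connects N i j -> ~~ is_entry (kind N j).
Proof. by move=> /andP[+ /eqP ij]; rewrite ij -begins_None. Qed.

Lemma next_road_nth (s : seq 'I_m) j0 k : uniq s -> (k.+1 < size s)%N ->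
  next_road s (nth j0 s k) = nth j0 s k.+1.
Proof.
move=> us ks; rewrite /next_road index_uniq //; last exact: ltnW.
exact: set_nth_default.
Qed.

End network_facts.

Section speed_facts.
Variables (R : realType) (m n : nat) (N : network R m) (l : R).
Variables (V : 'I_m -> R) (v : 'I_m -> R -> R) (route : 'I_n -> seq 'I_m).
Hypothesis l_gt0 : 0 < l.
Hypothesis v_law : forall j, speed_law (V j) (v j).
Hypothesis route_valid : forall a, valid_route N (route a).
Hypothesis route_exit : forall a, {in route a, forall j,
  ~~ is_exit (kind N j) -> connects N j (next_road (route a) j)}.

Local Notation speed := (speed N l V v route).

Definition valid_state (r : 'I_n -> 'I_m) (x : 'I_n -> R) :=
  forall b, r b \in route b /\ x b \in road_interval N (r b).

Definition ahead (r : 'I_n -> 'I_m) (x : 'I_n -> R) (a : 'I_n) : {set 'I_n} :=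
  [set b | (r b == r a) && (x a < x b)]%SET.

Definition on_next (r : 'I_n -> 'I_m) (a : 'I_n) : {set 'I_n} :=
  [set b | r b == next_road (route a) (r a)]%SET.

Definition top_priority (r : 'I_n -> 'I_m) (a : 'I_n) : bool :=
  [forall j in [set j | ends N j == ends N (r a)]%SET, (r a <= j)%N].

Definition yields (r : 'I_n -> 'I_m) (x : 'I_n -> R) (a b : 'I_n) : bool :=
  [&& ends N (r b) == ends N (r a), (r b < r a)%N & road_end N (r b) - l <= x b].

Definition follow_next (r : 'I_n -> 'I_m) (a : 'I_n) (y : 'I_n -> R) : R :=
  if min_pos y (on_next r a) is Some p
  then gap_speed l v (r a) (p + road_end N (r a) - y a) else V (r a).

(* The speed of the driver [a] at the positions [y], when the leader and the
   rights of way are those of the positions [x]. *)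
Definition frozen_speed (r : 'I_n -> 'I_m) (x : 'I_n -> R) (a : 'I_n)
    (y : 'I_n -> R) : R :=
  if min_pos y (ahead r x a) is Some p then gap_speed l v (r a) (p - y a)
  else if ~~ at_end N l (r a) (x a) then V (r a)
  else if top_priority r a then follow_next r a y
  else if [exists b, yields r x a b] then 0
  else follow_next r a y.

Lemma valid_lt_end r x b : valid_state r x -> ~~ is_exit (kind N (r b)) ->
  x b < road_end N (r b).
Proof.
by move=> /(_ b)[_]; rewrite road_intervalE => /andP[_ /orP[->|]].
Qed.

Lemma valid_on_next_ge0 r x a b : valid_state r x ->
  ~~ is_exit (kind N (r a)) -> b \in on_next r a -> 0 <= x b.
Proof.
move=> rx ea; rewrite finset.inE => /eqP rb.
have [ra _] := rx a; have := connects_not_entry (route_exit ra ea).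
by have [_] := rx b; rewrite road_intervalE rb => /andP[/orP[->|]].
Qed.

(** In a valid state every gap used as a denominator is positive, so [gap_speed] agrees with the
    law: a leader is strictly ahead, and a car on the next road is at a nonnegative position while
    [a] is still short of the end of its own road. *)
Lemma speed_frozen r x a : valid_state r x -> speed r x a = frozen_speed r x a x.
Proof.
move=> rx; rewrite /Defs.speed /frozen_speed -/(ahead r x a) -/(on_next r a).
rewrite -/(top_priority r a).
have /= := min_posP x (ahead r x a); case: (min_pos x (ahead r x a)) => [p|_].
  move=> [b]; rewrite finset.inE => /andP[_ ab] [-> _].
  by rewrite (gap_speedE l_gt0 v_law) ?subr_gt0.
have [aend|//] := boolP (at_end N l (r a) (x a)).
have -> : (if min_pos x (on_next r a) is Some p
    then v (r a) (l / (p + road_end N (r a) - x a)) else V (r a)) =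
    follow_next r a x.
  rewrite /follow_next; have := min_posP x (on_next r a).
  case: (min_pos x (on_next r a)) => // p [b bn [-> _]].
  move: aend; rewrite at_endE => /andP[ea /andP[_ xa]].
  have := valid_on_next_ge0 rx ea bn => xb.
  by rewrite (gap_speedE l_gt0 v_law) //; lra.
case: ifP => // _; congr (if _ then _ else _).
apply/idP/existsP => [/finset.set0Pn[b /bigcupP[j /andP[]]]|[b /and3P[eb rb xb]]].
  rewrite !finset.inE => ej ja /andP[/eqP rb xb].
  by exists b; rewrite /yields rb ej ja.
apply/finset.set0Pn; exists b; apply/bigcupP; exists (r b).
  by rewrite finset.inE eb.
by rewrite finset.inE eqxx.
Qed.

Lemma follow_next_range r a y : 0 <= follow_next r a y <= V (r a).
Proof.
rewrite /follow_next; case: (min_pos _ _) => [p|].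
  exact: (gap_speed_range l_gt0 v_law).
rewrite lexx andbT.
by have /andP[] := gap_speed_range l_gt0 v_law (r a) 0; exact: le_trans.
Qed.

Lemma frozen_speed_range r x a y : 0 <= frozen_speed r x a y <= V (r a).
Proof.
have V0 : 0 <= V (r a).
  by have /andP[] := gap_speed_range l_gt0 v_law (r a) 0; exact: le_trans.
rewrite /frozen_speed; case: (min_pos _ _) => [p|].
  exact: (gap_speed_range l_gt0 v_law).
have := follow_next_range r a y.
by case: ifP; rewrite ?V0 ?lexx //; case: ifP => //; case: ifP; rewrite // lexx V0.
Qed.

(** The branch taken depends on [r] and [x] only, never on [y]. The factor [2] appears because a gap
    involves two positions, each of which moves by at most [d]. *)
Lemma frozen_speed_lipschitz : exists2 K, 0 <= K & forall r x a y y' d,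
  (forall b, `|y b - y' b| <= d) ->
  `|frozen_speed r x a y - frozen_speed r x a y'| <= K * d.
Proof.
have [K K0 KP] := gap_speed_lipschitz l_gt0 v_law.
exists (2 * K) => [|r x a y y' d yd]; first by rewrite mulr_ge0.
have d0 : 0 <= d by apply: le_trans (yd a).
have Kd0 : 0 <= 2 * K * d by rewrite !mulr_ge0.
have gapP c p q : `|p - q| <= d -> `|gap_speed l v (r a) (p + c - y a) -
    gap_speed l v (r a) (q + c - y' a)| <= 2 * K * d.
  move=> pq; apply: le_trans (KP _ _ _) _.
  rewrite -mulrA mulrCA ler_wpM2l //.
  have -> : p + c - y a - (q + c - y' a) = (p - q) - (y a - y' a) by lra.
  by apply: le_trans (ler_normB _ _) _; have := yd a; lra.
have followP : `|follow_next r a y - follow_next r a y'| <= 2 * K * d.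
  rewrite /follow_next; case py: (min_pos y _) => [p|]; case qy: (min_pos y' _) => [q|].
  - by apply: gapP; exact: min_pos_close yd py qy.
  - by rewrite (min_pos_None y qy) in py.
  - by rewrite (min_pos_None y' py) in qy.
  - by rewrite subrr normr0.
rewrite /frozen_speed; case py: (min_pos y _) => [p|]; case qy: (min_pos y' _) => [q|].
- have := gapP 0 p q; rewrite !addr0; apply; exact: min_pos_close yd py qy.
- by rewrite (min_pos_None y qy) in py.
- by rewrite (min_pos_None y' py) in qy.
- by do 3![case: ifP => _; rewrite ?subrr ?normr0 //].
Qed.

Lemma speed_range r x a : valid_state r x -> 0 <= speed r x a <= V (r a).
Proof. by move=> rx; rewrite speed_frozen // frozen_speed_range. Qed.

Lemma speed_eq0_close r x a b : valid_state r x -> r b = r a -> x a < x b ->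
  x b <= x a + l -> speed r x a = 0.
Proof.
move=> rx rab ab abl; rewrite speed_frozen // /frozen_speed.
have bA : b \in ahead r x a by rewrite finset.inE rab eqxx.
have := min_posP x (ahead r x a); case: (min_pos _ _) => [p|A0].
  move=> [c _ [_ /(_ b bA) pb]]; apply: (gap_speed_eq0 l_gt0 v_law); lra.
by rewrite A0 finset.in_set0 in bA.
Qed.

(** Each failure would force the speed [0]. In particular the last stretch of a road has length [l],
    so any car ahead of [a] there would be within [l] of it. *)
Lemma speed_neq0_at_end r x a : valid_state r x -> at_end N l (r a) (x a) ->
  speed r x a != 0 ->
  [/\ forall b, r b = r a -> x b <= x a,
      forall b, b \in on_next r a -> l < x b + road_end N (r a) - x a &
      forall b, ~~ yields r x a b].
Proof.
move=> rx aend sn0; have := aend; rewrite at_endE => /andP[ea /andP[la xa]].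
have noahead b : r b = r a -> x b <= x a.
  move=> rb; rewrite leNgt; apply/negP => ab; case/eqP: sn0.
  apply: (speed_eq0_close rx rb ab).
  have := valid_lt_end rx (_ : ~~ is_exit (kind N (r b))).
  by rewrite rb => /(_ ea); lra.
have A0 : min_pos x (ahead r x a) = None.
  have := min_posP x (ahead r x a); case: (min_pos _ _) => // p [b].
  by rewrite finset.inE => /andP[/eqP /noahead]; rewrite leNgt => /negbTE->.
have noyield b : ~~ yields r x a b.
  apply/negP => yb; case/eqP: sn0; rewrite speed_frozen // /frozen_speed A0 aend /=.
  case: ifP => [/forallP/(_ (r b))|_].
    by case/and3P: yb => eb rb _; rewrite finset.inE eb /= leqNgt rb.
  by case: ifP => // /existsP; case; exists b.
split => // b bn; rewrite ltNge; apply/negP => bl; case/eqP: sn0.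
have F0 : follow_next r a x = 0.
  rewrite /follow_next; have := min_posP x (on_next r a).
  case: (min_pos _ _) => [p [c _ [_ /(_ b bn) pb]]|B0].
    apply: (gap_speed_eq0 l_gt0 v_law); lra.
  by rewrite B0 finset.in_set0 in bn.
rewrite speed_frozen // /frozen_speed A0 aend /= F0.
by case: ifP => // _; case: ifP.
Qed.

(* Positions only increase, so moving slightly forward changes neither the
   order of the drivers nor who is at the end of a road. *)
Lemma speed_right_frozen r x : valid_state r x ->
  (forall a b, a != b -> r a = r b -> x a != x b) ->
  exists2 e, 0 < e & forall y, (forall b, x b <= y b < x b + e) ->
    valid_state r y /\ forall a, speed r y a = frozen_speed r x a y.
Proof.
move=> rx rsep.
(* Three margins: between distinct positions, to the last stretch of a road, and to the end of a
   road. *)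
have [e1 e10 e1P] := pos_lower_bound (fun ab : 'I_n * 'I_n => x ab.2 - x ab.1).
have [e2 e20 e2P] := pos_lower_bound (fun b => road_end N (r b) - l - x b).
have [e3 e30 e3P] := pos_lower_bound (fun b => road_end N (r b) - x b).
exists (Num.min e1 (Num.min e2 e3)); first by rewrite !lt_min e10 e20.
move=> y xy.
have {}xy b : [/\ x b <= y b, y b < x b + e1, y b < x b + e2 & y b < x b + e3].
  have /andP[xyb] := xy b; rewrite -ltrBlDl !lt_min => /and3P[? ? ?].
  by split => //; lra.
have endE b : (y b < road_end N (r b)) = (x b < road_end N (r b)).
  have [xyb _ _ ye] := xy b.
  apply/idP/idP => [/(le_lt_trans xyb)//|xe].
  by have := e3P b; rewrite subr_gt0 => /(_ xe); lra.
have zoneE b : (road_end N (r b) - l <= y b) = (road_end N (r b) - l <= x b).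
  have [xyb _ ye _] := xy b; apply/idP/idP => [|/le_trans]; last exact.
  apply: contraTT; rewrite -!ltNge => xe.
  by have := e2P b; rewrite subr_gt0 => /(_ xe); lra.
have ry : valid_state r y.
  move=> b; have [rb xb] := rx b; split => //; move: xb.
  rewrite !road_intervalE endE => /andP[/orP[->//|x0] ->]; rewrite andbT.
  by have [xyb _ _ _] := xy b; rewrite (le_trans x0 xyb) orbT.
have ltE a b : x a < x b -> y a < y b.
  move=> ab; have [_ ya _ _] := xy a; have [yb _ _ _] := xy b.
  by have := e1P (a, b); rewrite /= subr_gt0 => /(_ ab); lra.
have aheadE a : ahead r y a = ahead r x a.
  apply/setP => b; rewrite !finset.inE; have [rab|//] := eqVneq (r b) (r a).
  apply/idP/idP => /=; last exact: ltE.
  apply: contraTT; rewrite -!leNgt le_eqVlt => /predU1P[xba|/ltE/ltW//].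
  (* Two cars at the same position could become ordered either way; the separation hypothesis
     excludes this case. *)
  have [->//|ba] := eqVneq b a; have /eqP := rsep _ _ ba rab.
  by rewrite xba.
split=> // a; rewrite speed_frozen // /frozen_speed aheadE !at_endE zoneE endE.
have -> // : [exists b, yields r y a b] = [exists b, yields r x a b].
by apply: eq_existsb => b; rewrite /yields zoneE.
Qed.

End speed_facts.

(** * First and last zeros of Lipschitz functions *)

Definition lipschitz_between (R : realType) (K : R) (f : R -> R) (a b : R) :=
  forall x y, a <= x -> x <= y -> y <= b -> `|f y - f x| <= K * (y - x).

(** Without such a zero, negativity would propagate up to [b] by real induction: a first nonnegative
    point is a zero by continuity from the left, and after a point where [f] is negative the
    Lipschitz bound keeps it negative for a while. *)
Lemma first_nonneg (R : realType) (K : R) (f : R -> R) (a b : R) :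
  lipschitz_between K f a b -> a <= b -> f a < 0 -> 0 <= f b ->
  exists c, [/\ a < c, c <= b, f c = 0 & forall u, a <= u -> u < c -> f u < 0].
Proof.
move=> fK ab fa fb; apply: contrapT => nc.
have D0 : 0 < `|K| + 1 by rewrite ltr_wpDl.
have fD x y : a <= x -> x <= y -> y <= b -> `|f y - f x| <= (`|K| + 1) * (y - x).
  move=> ax xy yb; apply: le_trans (fK _ _ ax xy yb) _.
  by rewrite ler_wpM2r ?subr_ge0 //; have := ler_norm K; lra.
have : f b < 0; last by rewrite ltNge fb.
apply: (@real_induction _ a b (fun x => f x < 0)); last by rewrite ab lexx.
- move=> x /andP[ax xb] fx; rewrite ltNge; apply/negP => x0; apply: nc; exists x.
  have ltax : a < x.
    rewrite lt_neqAle ax andbT; apply/eqP => ax'; move: fa.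
    by rewrite ax' ltNge x0.
  split => //; last by move=> u au ux; apply: fx; rewrite au.
  apply/eqP; rewrite eq_le x0 andbT; apply/ler_addgt0Pr => e e0.
  pose u := Num.max a (x - e / (`|K| + 1)).
  have ux : u < x.
    by rewrite gt_max ltax /= gtrBl divr_gt0.
  have au : a <= u by rewrite le_max lexx.
  have /ler_normlP[_] := fD _ _ au (ltW ux) xb.
  have := fx u; rewrite au ux => /(_ isT).
  have : (`|K| + 1) * (x - u) <= e.
    rewrite mulrC -ler_pdivlMr // lerBlDl -lerBlDr /u.
    by rewrite le_max lexx orbT.
  by lra.
- move=> x /andP[ax xb] /(_ x); rewrite ax lexx => /(_ isT) fx.
  exists (Num.min (b - x) (- f x / (`|K| + 1))).
    by rewrite lt_min subr_gt0 xb divr_gt0 // oppr_gt0.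
  move=> y /andP[xy]; rewrite -ltrBlDl lt_min => /andP[yb].
  rewrite ltr_pdivlMr // => yf.
  have yb' : y <= b by lra.
  by have /ler_normlP[_] := fD _ _ ax (ltW xy) yb'; lra.
Qed.

Lemma last_nonneg (R : realType) (K : R) (f : R -> R) (a b : R) :
  lipschitz_between K f a b -> a <= b -> 0 <= f a -> f b < 0 ->
  exists c, [/\ a <= c, c < b, f c = 0 & forall u, c < u -> u <= b -> f u < 0].
Proof.
move=> fK ab fa fb.
have [||||c [ac cb fc cP]] := @first_nonneg R K (fun u => f (a + b - u)) a b.
- move=> x y ax xy yb; rewrite distrC.
  have -> : y - x = (a + b - x) - (a + b - y) by lra.
  by apply: fK; lra.
- by [].
- by have -> : a + b - a = b by lra.
- by have -> : a + b - b = a by lra.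
exists (a + b - c); split => //; [lra|lra|].
move=> u cu ub; have := cP (a + b - u).
have -> : a + b - (a + b - u) = u by lra.
by apply; lra.
Qed.

(** * Lipschitz differential systems *)

Section picard.
Variable R : realType.

Lemma slope_bounds (f df : R -> R) (a b c c' : R) : a <= b ->
  (forall x, a <= x <= b -> has_slope f x (df x)) ->
  (forall x, a <= x <= b -> c <= df x <= c') ->
  c * (b - a) <= f b - f a <= c' * (b - a).
Proof.
(* In [K], the term [1] is the tolerance chosen in [has_slope], and the other two bound the slope
   itself. *)
move=> ab fs dfc; pose K := `|c| + `|c'| + 1.
have K0 : 0 < K by rewrite ltr_wpDl // addr_ge0.
have fK x : a <= x <= b -> exists2 h, 0 < h &
    forall u, `|u - x| < h -> `|f u - f x| <= K * `|u - x|.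
  move=> xab; have [h h0 fh] := fs x xab 1 ltr01; exists h => // u /fh fu.
  have -> : f u - f x = (f u - f x - df x * (u - x)) + df x * (u - x) by lra.
  apply: le_trans (ler_normD _ _) _.
  rewrite /K mulrDl addrC lerD // normrM ler_wpM2r //.
  have /andP[cd dc] := dfc x xab.
  have := ler_norm c'; have := ler_norm (- c); rewrite normrN.
  have := normr_ge0 c; have := normr_ge0 c'.
  by move=> ? ? ? ?; apply/ler_normlP; split; lra.
apply: (ae_slope_bounds (K := K)) => //; first exact: ltW.
- move=> x /andP[ax xb] e e0; have [|h h0 fh] := fK x; first by rewrite ltW.
  exists (Num.min h (e / K)); first by rewrite lt_min h0 divr_gt0.
  move=> u /andP[xu ux] au.
  have : x - u < Num.min h (e / K) by lra.
  rewrite lt_min ltr_pdivlMr // => /andP[xh xe].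
  have := fh u; rewrite ltr0_norm ?subr_lt0 // opprB => /(_ xh).
  by lra.
- move=> x /andP[ax xb]; have [|h h0 fh] := fK x; first by rewrite ax ltW.
  exists h => // u /andP[xu uh]; have := fh u.
  by rewrite gtr0_norm ?subr_gt0 //; apply; lra.
- apply: aeW => t /andP[at_ tb]; have tab : a <= t <= b by rewrite !ltW.
  by exists (df t); [exact: dfc|exact: fs].
Qed.

(** The lower bound [a] of the integral is kept strictly to the left of the points considered, so
    that the slopes are two-sided. *)
Lemma lipschitz_antiderivative (f : R -> R) (K a : R) :
  (forall x y, `|f x - f y| <= K * `|x - y|) ->
  exists F, forall x, a < x -> has_slope F x (f x).
Proof.
move=> fK; have cf : continuous f.
  move=> x; apply/cvgrPdist_le => e e0.
  have D0 : 0 < `|K| + 1 by rewrite ltr_wpDl.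
  apply/itv_nbhs; exists (e / (`|K| + 1)); first exact: divr_gt0.
  move=> u; rewrite ltr_pdivlMr // => ux; rewrite distrC.
  apply: le_trans (fK u x) _.
  have := ler_wpM2r (normr_ge0 (u - x)) (ler_norm K).
  by have := normr_ge0 (u - x); lra.
exists (fun x => \int[@lebesgue_measure R]_(t in [set` `[a, x]]) f t)%R => x ax.
have xx1 : x < x + 1 by rewrite ltrDl.
have intf : (@lebesgue_measure R).-integrable [set` `[a, x + 1]] (EFin \o f).
  apply: continuous_compact_integrable; first exact: segment_compact.
  exact: continuous_subspaceT.
have [dF FE] := continuous_FTC1_closed xx1 intf ax (cf x).
apply/has_slopeP; split; first exact: dF.
by rewrite -FE derive1E.
Qed.

Lemma le0_of_halving (c d : R) : (forall k, c <= d / 2 ^+ k) -> c <= 0.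
Proof.
move=> cd; rewrite leNgt; apply/negP => c0.
have d0 : 0 < d by have := cd 0%N; rewrite expr0 divr1; exact: lt_le_trans.
have := cd (Num.bound (d / c)); rewrite ler_pdivlMr ?exprn_gt0 //.
rewrite leNgt => /negP; apply; rewrite mulrC -ltr_pdivrMr //.
apply: lt_le_trans (archi_boundP _) _; first by rewrite divr_ge0 // ltW.
by rewrite -natrX ler_nat ltnW // ltn_expl.
Qed.

(** Nested intervals: [2 * D / 2 ^+ k] is the sum of all the later steps, so [u k] minus it
    increases and [u k] plus it decreases. The limit comes with its rate of convergence. *)
Lemma halving_limit (u : nat -> R) (D : R) : 0 <= D ->
  (forall k, `|u k.+1 - u k| <= D / 2 ^+ k) ->
  exists y, forall k, `|y - u k| <= 2 * D / 2 ^+ k.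
Proof.
move=> D0 uD; have half k : 2 * D / 2 ^+ k.+1 = D / 2 ^+ k.
  by rewrite exprS invfM mulrACA divff // mul1r.
have half' k : 2 * D / 2 ^+ k = D / 2 ^+ k + D / 2 ^+ k.
  by rewrite mulr_natl mulr2n mulrDl.
pose z k := u k - 2 * D / 2 ^+ k; pose w k := u k + 2 * D / 2 ^+ k.
have zS k : z k <= z k.+1.
  by rewrite /z half half'; have /ler_normlP[] := uD k; lra.
have wS k : w k.+1 <= w k.
  by rewrite /w half half'; have /ler_normlP[] := uD k; lra.
have zw i k : z i <= w k.
  have zi : z i <= z (maxn i k).
    rewrite -(subnKC (leq_maxl i k)); elim: (maxn i k - i)%N => [|d IH].
      by rewrite addn0.
    by rewrite addnS (le_trans IH).
  have wk : w (maxn i k) <= w k.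
    rewrite -(subnKC (leq_maxr i k)); elim: (maxn i k - k)%N => [|d IH].
      by rewrite addn0.
    by rewrite addnS (le_trans (wS _)).
  apply: le_trans zi (le_trans _ wk).
  have : 0 <= 2 * D / 2 ^+ (maxn i k) by rewrite divr_ge0 // mulr_ge0.
  by rewrite /z /w; lra.
have zsup : has_sup (range z).
  by split; [exists (z 0%N); exists 0%N|exists (w 0%N) => _ [i _ <-]].
exists (sup (range z)) => k.
have : z k <= sup (range z) by apply: ub_le_sup; [case: zsup|exists k].
have : sup (range z) <= w k by apply: ge_sup; [case: zsup|move=> _ [i _ <-]].
by rewrite /z /w => ? ?; apply/ler_normlP; split; lra.
Qed.

Variables (n : nat) (G : ('I_n -> R) -> 'I_n -> R) (W K : R).
Hypothesis W_ge0 : 0 <= W.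
Hypothesis K_ge0 : 0 <= K.
Hypothesis G_range : forall y a, 0 <= G y a <= W.
Hypothesis G_lipschitz : forall y y' d a, (forall b, `|y b - y' b| <= d) ->
  `|G y a - G y' a| <= K * d.

Let nondecreasing_lipschitz (Y : 'I_n -> R -> R) := forall a s t, s <= t ->
  0 <= Y a t - Y a s <= W * (t - s).

Let nd_norm Y a s t : nondecreasing_lipschitz Y -> `|Y a t - Y a s| <= W * `|t - s|.
Proof.
move=> YW; case: (leP s t) => [st|/ltW ts].
  by have /andP[? ?] := YW a _ _ st; rewrite !ger0_norm ?subr_ge0 //; lra.
rewrite distrC [`|t - s|]distrC.
by have /andP[? ?] := YW a _ _ ts; rewrite !ger0_norm ?subr_ge0 //; lra.
Qed.

(** The hypothesis on [Y] stands under the existential so that [choice] gives a total map, which can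
    be iterated. Integrating from [-1] makes [0] an interior point, and [Num.max 0 t] makes the new
    curve constant at negative times, hence nondecreasing and Lipschitz on the whole line. *)
Lemma picard_step (x : 'I_n -> R) (Y : 'I_n -> R -> R) :
  exists Z, nondecreasing_lipschitz Y ->
  [/\ nondecreasing_lipschitz Z, forall a, Z a 0 = x a &
      forall a t, 0 < t -> has_slope (Z a) t (G (Y^~ t) a)].
Proof.
have [YW|nY] := pselect (nondecreasing_lipschitz Y); last by exists Y.
have /choice[F FP] : forall a, exists F, forall t, -1 < t ->
    has_slope F t (G (Y^~ t) a).
  move=> a; apply: (@lipschitz_antiderivative _ (K * W)) => s t.
  by rewrite -mulrA; apply: G_lipschitz => b; exact: nd_norm.
exists (fun a t => x a + (F a (Num.max 0 t) - F a 0)) => _; split.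
- move=> a s t st.
  have s0 : 0 <= Num.max 0 s by rewrite le_max lexx.
  have st' : Num.max 0 s <= Num.max 0 t by rewrite ge_max !le_max lexx st orbT.
  have st'' : Num.max 0 t - Num.max 0 s <= t - s.
    by case: (leP 0 t); case: (leP 0 s); lra.
  have := @slope_bounds (F a) (fun u => G (Y^~ u) a) _ _ 0 W st'.
  case/(_ _ _)/andP => [u /andP[su _]|u _|]; [apply: FP; lra|exact: G_range|].
  rewrite mul0r => F0 FW; apply/andP; split; first lra.
  apply: le_trans (_ : W * (Num.max 0 t - Num.max 0 s) <= _); first lra.
  by rewrite ler_wpM2l.
- by move=> a; rewrite max_l // subrr addr0.
- move=> a t t0; apply: (@near_has_slope _ (F a) _ _ _ t) => //; last by apply: FP; lra.
  move=> u ut; have u0 : 0 < u by have /ltr_normlP[] := ut; lra.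
  by rewrite !max_r ?ltW //; lra.
Qed.

Lemma picard (x : 'I_n -> R) : exists2 d, 0 < d & exists Y : 'I_n -> R -> R,
  [/\ forall a, Y a 0 = x a,
      forall a s t, 0 <= s -> s <= t -> t <= d -> 0 <= Y a t - Y a s <= W * (t - s) &
      forall a t, 0 < t < d -> has_slope (Y a) t (G (Y^~ t) a)].
Proof.
have [step stepP] := choice (picard_step x).
pose Y k := iter k step (fun a _ => x a).
have Y_lip k : nondecreasing_lipschitz (Y k).
  elim: k => [|k /stepP[]//] a s t st.
  by rewrite subrr lexx mulr_ge0 // subr_ge0.
have Y0 k a : Y k a 0 = x a.
  by case: k => // k; have [_ init _] := stepP _ (Y_lip k); exact: init.
have Y_slope k a t : 0 < t -> has_slope (Y k.+1 a) t (G (Y k ^~ t) a).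
  by have [_ _] := stepP _ (Y_lip k); exact.
(* This gives [K * d <= 1 / 2], so each iteration halves the distance between successive curves. *)
pose d := (2 * (K + 1))^-1.
have d0 : 0 < d by rewrite invr_gt0 mulr_gt0 // ltr_wpDl.
have Kd : K * d <= 1 / 2.
  rewrite /d invfM mulrCA -ler_pdivlMl ?invr_gt0 // invrK mul1r mulfV //.
  by rewrite ler_pdivrMr ?mul1r ?ltr_wpDl // lerDl.
pose D := W * d; have D0 : 0 <= D by rewrite mulr_ge0 // ltW.
have contract k a t : 0 <= t -> t <= d -> `|Y k.+1 a t - Y k a t| <= D / 2 ^+ k.
  elim: k a t => [|k IH] a t t0 td.
    rewrite expr0 divr1; have /andP[? ?] := Y_lip 1%N a _ _ t0.
    rewrite -[X in _ - X](Y0 1%N a) ger0_norm //.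
    apply: le_trans (_ : W * (t - 0) <= _) => //.
    by rewrite subr0 ler_wpM2l.
  have Yd u : 0 < u < t -> `|G (Y k.+1 ^~ u) a - G (Y k ^~ u) a| <= K * (D / 2 ^+ k).
    move=> /andP[u0 ut]; apply: G_lipschitz => b; apply: IH; first exact: ltW.
    exact: le_trans (ltW ut) td.
  suff : - (K * (D / 2 ^+ k)) * (t - 0) <=
      (Y k.+2 a t - Y k.+1 a t) - (Y k.+2 a 0 - Y k.+1 a 0) <=
      K * (D / 2 ^+ k) * (t - 0).
    rewrite !Y0 subrr !subr0 mulNr -ler_norml => /le_trans; apply.
    have -> : D / 2 ^+ k.+1 = D / 2 ^+ k * (1 / 2).
      by rewrite exprS invfM mul1r mulrCA mulrC.
    have q0 : 0 <= D / 2 ^+ k by rewrite divr_ge0.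
    have Kt : K * t <= 1 / 2 by apply: le_trans Kd; rewrite ler_wpM2l.
    by have := ler_wpM2l q0 Kt; lra.
  apply: (@lipschitz_ae_slope_bounds _ (fun u => Y k.+2 a u - Y k.+1 a u)
    _ _ (W + W)) => //.
    move=> u w u0 uw wt; have /andP[? ?] := Y_lip k.+2 a _ _ uw.
    have /andP[? ?] := Y_lip k.+1 a _ _ uw.
    by apply/ler_normlP; split; lra.
  apply: aeW => u ut; have /andP[u0 _] := ut.
  exists (G (Y k.+1 ^~ u) a - G (Y k ^~ u) a); first by rewrite -ler_norml Yd.
  by apply: has_slopeB; exact: Y_slope.
have /choice[Z ZP] : forall at_ : 'I_n * R, exists z, 0 <= at_.2 <= d ->
    forall k, `|z - Y k at_.1 at_.2| <= 2 * D / 2 ^+ k.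
  move=> [a t]; have [/andP[t0 td]|nt] := boolP (0 <= t <= d); last by exists 0.
  have [z zP] := @halving_limit (fun k => Y k a t) D D0 (fun k => contract k a t t0 td).
  by exists z.
have {}ZP a t : 0 <= t -> t <= d -> forall k, `|Z (a, t) - Y k a t| <= 2 * D / 2 ^+ k.
  by move=> t0 td; apply: (ZP (a, t)); rewrite t0.
exists d => //; exists (fun a t => Z (a, t)).
have le_limit (c c' B : R) : (forall k, c <= c' + B / 2 ^+ k) -> c <= c'.
  move=> H; rewrite -subr_le0; apply: (@le0_of_halving _ B) => k.
  by rewrite lerBlDl.
have half2 k : 4 * D / 2 ^+ k = 2 * D / 2 ^+ k + 2 * D / 2 ^+ k.
  by rewrite -mulrDl; congr (_ / _); lra.
split.
- move=> a; apply/eqP; rewrite -subr_eq0 -normr_le0.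
  apply: (@le0_of_halving _ (2 * D)) => k.
  by have := ZP a 0 (lexx _) (ltW d0) k; rewrite Y0.
- move=> a s t s0 st td; have t0 := le_trans s0 st; have sd := le_trans st td.
  apply/andP; split; apply: (@le_limit _ _ (4 * D)) => k;
    have /andP[? ?] := Y_lip k a _ _ st;
    have /ler_normlP[? ?] := ZP a s s0 sd k;
    have /ler_normlP[? ?] := ZP a t t0 td k; rewrite half2; lra.
- move=> a s /andP[s0 sd].
  have KW0 : 0 <= K * W by rewrite mulr_ge0.
  (* Slopes do not pass to uniform limits directly. Around [s], the slope of each iterate differs
     from [G] at the limit curve by at most [K * (W * (q - p) + e)]; letting [k] grow removes [e]
     and leaves an error quadratic in [q - p]. *)
  have expand p q : 0 < p -> p <= s -> s <= q -> q < d ->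
      `|Z (a, q) - Z (a, p) - (q - p) * G (fun b => Z (b, s)) a| <=
      K * W * (q - p) * (q - p).
    move=> p0 ps sq qd; have pq := le_trans ps sq.
    apply: (@le_limit _ _ (4 * D + (q - p) * (K * (2 * D)))) => k.
    set e := 2 * D / 2 ^+ k.
    have e0 : 0 <= e by rewrite divr_ge0 // mulr_ge0.
    have -> : (4 * D + (q - p) * (K * (2 * D))) / 2 ^+ k = 2 * e + (q - p) * K * e.
      by rewrite /e; set i := (2 ^+ k)^-1; lra.
    have eS : 2 * D / 2 ^+ k.+1 <= e.
      rewrite /e exprS invfM mulrCA -/e ler_piMl // invf_le1 //.
      by rewrite ler1n.
    set g := G _ a; pose h := K * (W * (q - p) + e).
    have Gg u : p < u < q -> g - h <= G (Y k ^~ u) a <= g + h.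
      move=> /andP[pu uq]; rewrite -ler_distl; apply: G_lipschitz => b.
      have -> : Y k b u - Z (b, s) = (Y k b u - Y k b s) - (Z (b, s) - Y k b s) by lra.
      apply: le_trans (ler_normB _ _) _; apply: lerD.
        apply: le_trans (nd_norm _ _ _ (Y_lip k)) _; rewrite ler_wpM2l //.
        by apply/ler_normlP; split; lra.
      by apply: ZP; exact: ltW.
    have /andP[Yl Yr] : (g - h) * (q - p) <= Y k.+1 a q - Y k.+1 a p <=
        (g + h) * (q - p).
      apply: (@lipschitz_ae_slope_bounds _ _ _ _ W) => //.
        move=> u w _ uw _; have /andP[? ?] := Y_lip k.+1 a _ _ uw.
        by rewrite ger0_norm.
      apply: aeW => u pq'; exists (G (Y k ^~ u) a); first exact: Gg.
      by apply: Y_slope; case/andP: pq'; lra.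
    have /ler_normlP[Zq1 Zq2] := ZP a q (ltW (lt_le_trans p0 pq)) (ltW qd) k.+1.
    have /ler_normlP[Zp1 Zp2] := ZP a p (ltW p0) (ltW (le_lt_trans pq qd)) k.+1.
    by rewrite /h in Yl Yr; apply/ler_normlP; split; lra.
  move=> e e0; have D1 : 0 < K * W + 1 by rewrite ltr_wpDl.
  exists (Num.min (Num.min s (d - s)) (e / (K * W + 1))).
    by rewrite !lt_min s0 subr_gt0 sd divr_gt0.
  move=> u; rewrite !lt_min ltr_pdivlMr // => /andP[/andP[us ud] ue].
  have KWe z : 0 <= z -> z * (K * W + 1) <= e -> K * W * z * z <= e * z.
    by move=> z0 ze; rewrite ler_wpM2r //; lra.
  have [su|us'] := leP s u.
    rewrite ger0_norm ?subr_ge0 // in us ud ue *.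
    have uld : u < d by lra.
    have := expand s u s0 (lexx s) su uld; rewrite [G _ a * _]mulrC => /le_trans; apply.
    by apply: KWe; [rewrite subr_ge0|exact: ltW].
  rewrite ltr0_norm ?subr_lt0 // opprB in us ud ue *.
  have u0 : 0 < u by lra.
  have := expand u s u0 (ltW us') (lexx s) sd.
  have -> : Z (a, u) - Z (a, s) - G (fun b => Z (b, s)) a * (u - s) =
    - (Z (a, s) - Z (a, u) - (s - u) * G (fun b => Z (b, s)) a) by lra.
  rewrite normrN => /le_trans; apply.
  by apply: KWe; [rewrite subr_ge0 ltW|exact: ltW].
Qed.

End picard.

(** * Abscissas along routes *)

Section traffic.
Variables (R : realType) (m n : nat) (N : network R m).
Variables (route : 'I_n -> seq 'I_m) (r0 : 'I_n -> 'I_m) (x0 : 'I_n -> R).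
Hypothesis route_valid : forall a, valid_route N (route a).
Hypothesis route_uniq : forall a, uniq (route a).
Hypothesis route_first : forall a, ohead (route a) = Some (r0 a).
Hypothesis route_last : forall a, kind N (last (r0 a) (route a)) = Exit.
Hypothesis x0_road : forall a, x0 a \in road_interval N (r0 a).
Variables (l Vmax : R) (V : 'I_m -> R) (v : 'I_m -> R -> R).
Hypothesis l_gt0 : 0 < l.
Hypothesis Vmax_ge0 : 0 <= Vmax.
Hypothesis V_le : forall j, V j <= Vmax.
Hypothesis v_law : forall j, speed_law (V j) (v j).
Hypothesis x0_spaced : forall a b : 'I_n,
  a != b -> r0 a = r0 b -> l <= `|x0 a - x0 b|.

Local Notation rd a k := (nth (r0 a) (route a) k).

Definition road_start (a : 'I_n) (k : nat) : R :=
  \sum_(i <- take k (route a)) road_end N i.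

(* [X] is an abscissa along the route of [a], as in [route_abscissa]. *)
Definition road_index (a : 'I_n) (X : R) : nat :=
  find (fun k => X < road_start a k.+1) (iota 0 (size (route a)).-1).

Definition road_at (a : 'I_n) (X : R) : 'I_m := rd a (road_index a X).

Definition pos_at (a : 'I_n) (X : R) : R := X - road_start a (road_index a X).

Lemma route_size_gt0 a : (0 < size (route a))%N.
Proof. by have := route_first a; case: (route a). Qed.

Lemma route_nth0 a : rd a 0 = r0 a.
Proof. by have := route_first a; case: (route a) => //= j s [->]. Qed.

Lemma route_not_exit a k : (k.+1 < size (route a))%N -> ~~ is_exit (kind N (rd a k)).
Proof.
by move=> ks; have /(sortedP (r0 a)) /(_ k ks) := route_valid a;
  exact: connects_not_exit.
Qed.

Lemma route_not_entry a k : (k.+1 < size (route a))%N ->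
  ~~ is_entry (kind N (rd a k.+1)).
Proof.
by move=> ks; have /(sortedP (r0 a)) /(_ k ks) := route_valid a;
  exact: connects_not_entry.
Qed.

Lemma route_last_exit a k : k.+1 = size (route a) -> kind N (rd a k) = Exit.
Proof. by move=> ks; rewrite -(route_last a) -nth_last -ks. Qed.

Lemma route_connects a : {in route a, forall j,
  ~~ is_exit (kind N j) -> connects N j (next_road (route a) j)}.
Proof.
move=> j jr; rewrite -(nth_index (r0 a) jr).
have := jr; rewrite -index_mem leq_eqVlt => /predU1P[/route_last_exit ->//|ks] _.
rewrite next_road_nth //.
by have /(sortedP (r0 a)) /(_ _ ks) := route_valid a.
Qed.

Lemma road_start0 a : road_start a 0 = 0.
Proof. by rewrite /road_start take0 big_nil. Qed.

Lemma road_startS a k : (k < size (route a))%N ->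
  road_start a k.+1 = road_start a k + road_end N (rd a k).
Proof.
move=> ks; rewrite /road_start (take_nth (r0 a)) // -cats1 big_cat /=.
by rewrite big_seq1.
Qed.

Lemma road_end_ge0 j : 0 <= road_end N j.
Proof.
rewrite /road_end /road_length; case jL: (kind N j) => [|L|] //=.
exact/ltW/(middle_length_gt0 jL).
Qed.

(** The index starts at [1] because [road_end] is [0] on an Entry Road: the starts of the first two
    roads may coincide. *)
Lemma road_start_lt a k : (k.+2 < size (route a))%N ->
  road_start a k.+1 < road_start a k.+2.
Proof.
move=> ks; rewrite (@road_startS a k.+1) ?(ltnW ks) // ltrDl.
have := route_not_exit ks; have := route_not_entry (ltnW ks).
rewrite /road_end /road_length; case jL: (kind N _) => [|L|] //= _ _.
exact: middle_length_gt0 jL.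
Qed.

Lemma road_start_mono a i k : (i <= k)%N -> (k < size (route a))%N ->
  road_start a i <= road_start a k.
Proof.
move=> ik; rewrite -(subnK ik); elim: (k - i)%N => [//|d IH ds].
rewrite addSn road_startS ?(ltnW ds) //.
by rewrite (le_trans (IH (ltnW ds))) // lerDl road_end_ge0.
Qed.

(** When no end of a road exceeds [X], [find] returns the length of the list, here the index of the
    last road: an Exit Road is never left. *)
Lemma road_index_lt a X : (road_index a X < size (route a))%N.
Proof.
rewrite -ltnS; apply: (@leq_ltn_trans (size (route a)).-1.+1).
  by rewrite ltnS; have := find_size (fun k => X < road_start a k.+1)
    (iota 0 (size (route a)).-1); rewrite size_iota.
by rewrite prednK ?route_size_gt0.
Qed.

Lemma road_index_ge a X k : road_index a X = k.+1 -> road_start a k.+1 <= X.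
Proof.
move=> idx; have := @before_find _ 0%N (fun k => X < road_start a k.+1)
  (iota 0 (size (route a)).-1) k.
rewrite -/(road_index a X) idx ltnSn => /(_ isT).
rewrite nth_iota ?add0n; last first.
  by have := road_index_lt a X; rewrite idx; case: (size _).
by move=> /negbT; rewrite -leNgt.
Qed.

Lemma road_index_le a X : ((road_index a X).+1 < size (route a))%N ->
  X < road_start a (road_index a X).+1.
Proof.
move=> idx; have fh : (road_index a X < size (iota 0 (size (route a)).-1))%N.
  by rewrite size_iota; move: idx; case: (size _).
have := fh; rewrite -has_find => /(nth_find 0%N).
by rewrite -/(road_index a X) nth_iota //; move: fh; rewrite size_iota.
Qed.

Lemma road_index_geP a X k : (k.+1 < size (route a))%N ->
  (k.+1 <= road_index a X)%N = (road_start a k.+1 <= X).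
Proof.
move=> ks; apply/idP/idP => [kX|].
  case iX: (road_index a X) kX => [//|i] ki.
  apply: le_trans (road_index_ge iX); apply: road_start_mono => //.
  by rewrite -iX road_index_lt.
apply: contraTT; rewrite -ltnNge -ltNge ltnS => Xk.
have Xs : ((road_index a X).+1 < size (route a))%N by apply: leq_ltn_trans ks.
by apply: lt_le_trans (road_index_le Xs) _; exact: road_start_mono.
Qed.

Lemma road_index_eq a X k : (k < size (route a))%N ->
  ((0 < k)%N -> road_start a k <= X) ->
  ((k.+1 < size (route a))%N -> X < road_start a k.+1) -> road_index a X = k.
Proof.
move=> ks kX Xk; apply/eqP; rewrite eqn_leq; apply/andP; split.
  rewrite leqNgt; apply/negP => ki.
  have ks' : (k.+1 < size (route a))%N by apply: leq_ltn_trans ki (road_index_lt _ _).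
  by move: ki; rewrite road_index_geP // leNgt Xk.
by case: k ks kX {Xk} => // k ks /(_ isT); rewrite road_index_geP.
Qed.

Lemma road_index_mono a X Y : X <= Y -> (road_index a X <= road_index a Y)%N.
Proof.
move=> XY; case iX: (road_index a X) => [//|k].
rewrite road_index_geP; last by rewrite -iX road_index_lt.
exact: le_trans (road_index_ge iX) XY.
Qed.

(** Roads are closed on the left, whence continuity from the right. There is none from the left at
    the start of a later road. *)
Lemma road_index_right a X : exists2 e, 0 < e &
  forall Y, X <= Y < X + e -> road_index a Y = road_index a X.
Proof.
have [Xs|Xs] := ltnP (road_index a X).+1 (size (route a)).
  exists (road_start a (road_index a X).+1 - X).
    by rewrite subr_gt0 road_index_le.
  move=> Y /andP[XY Ye]; apply: road_index_eq (road_index_lt _ _) _ _; last lra.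
  case iX: (road_index a X) => [//|k] _.
  exact: le_trans (road_index_ge iX) XY.
exists 1 => // Y /andP[XY _]; apply/eqP; rewrite eqn_leq (road_index_mono a XY) andbT.
by rewrite -ltnS (leq_trans (road_index_lt _ _)).
Qed.

Lemma index_road_at a X : index (road_at a X) (route a) = road_index a X.
Proof. by rewrite /road_at index_uniq // road_index_lt. Qed.

Lemma road_at_in a X : road_at a X \in route a.
Proof. by rewrite /road_at mem_nth // road_index_lt. Qed.

Lemma route_abscissa_at a X : route_abscissa N (route a) (road_at a X) (pos_at a X) = X.
Proof. by rewrite /route_abscissa index_road_at /pos_at addrC subrK. Qed.

Lemma next_road_at a X : ((road_index a X).+1 < size (route a))%N ->
  next_road (route a) (road_at a X) = rd a (road_index a X).+1.
Proof. by move=> Xs; rewrite next_road_nth. Qed.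

Lemma abscissa_decode a j y : j \in route a -> y \in road_interval N j ->
  road_at a (route_abscissa N (route a) j y) = j /\
  pos_at a (route_abscissa N (route a) j y) = y.
Proof.
move=> jr yj; set X := route_abscissa _ _ _ _.
have XE : X = road_start a (index j (route a)) + y by [].
have js : (index j (route a) < size (route a))%N by rewrite index_mem.
suff iX : road_index a X = index j (route a).
  by rewrite /road_at /pos_at iX nth_index // XE addrAC subrr add0r.
move: yj; rewrite road_intervalE => /andP[yl yr].
apply: road_index_eq => // [i0|is1].
  move: yl; rewrite -[in is_entry _](nth_index (r0 a) jr) XE lerDl.
  rewrite -(prednK i0) in js *.
  by rewrite (negbTE (route_not_entry _)).
rewrite XE road_startS // ltrD2l nth_index //.
by move: yr; rewrite -[in is_exit _](nth_index (r0 a) jr) (negbTE (route_not_exit is1)).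
Qed.

Lemma x0_abscissa a : route_abscissa N (route a) (r0 a) (x0 a) = x0 a.
Proof.
rewrite /route_abscissa -(route_nth0 a) index_uniq // ?route_size_gt0 //.
by rewrite take0 big_nil add0r.
Qed.

Lemma x0_decode a : road_at a (x0 a) = r0 a /\ pos_at a (x0 a) = x0 a.
Proof.
have r0r : r0 a \in route a by rewrite -(route_nth0 a) mem_nth ?route_size_gt0.
by have := abscissa_decode r0r (x0_road a); rewrite x0_abscissa.
Qed.

Lemma road_index_x0 a : road_index a (x0 a) = 0%N.
Proof.
rewrite -index_road_at (x0_decode a).1 -(route_nth0 a) index_uniq //.
exact: route_size_gt0.
Qed.

(** The bound by [x0 a] matters on the first road, whose positions are bounded below by [0] unless
    it is an Entry Road. *)
Lemma pos_at_interval a X : x0 a <= X -> pos_at a X \in road_interval N (road_at a X).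
Proof.
move=> xX; rewrite road_intervalE; apply/andP; split.
  have := xX; rewrite /pos_at /road_at; case iX: (road_index a X) => [|k] x0X.
    have := x0_road a; rewrite road_intervalE route_nth0 road_start0 subr0.
    by move=> /andP[/orP[->//|/le_trans/(_ x0X) ->]]; rewrite orbT.
  by rewrite subr_ge0 road_index_ge ?orbT.
have := road_index_lt a X; rewrite leq_eqVlt => /predU1P[/route_last_exit|Xs].
  by rewrite /road_at => ->.
by rewrite /pos_at ltrBlDl -road_startS ?road_index_le ?orbT // ltnW.
Qed.

(** * Spacing of the drivers *)

Local Notation roads X := (fun b => road_at b (X b)).
Local Notation positions X := (fun b => pos_at b (X b)).

Definition flow (X : 'I_n -> R) (a : 'I_n) : R :=
  speed N l V v route (roads X) (positions X) a.

Definition spaced (X : 'I_n -> R) := forall a b, a != b ->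
  road_at a (X a) = road_at b (X b) -> l <= `|pos_at a (X a) - pos_at b (X b)|.

(** Monotonicity and the uniform constant [Vmax] are part of the notion, although [solution] asks
    only for some Lipschitz constant on each road; for a given solution they are recovered from the
    almost everywhere speeds. *)
Record abscissa_solution (T : R) (X : 'I_n -> R -> R) : Prop := {
  abscissa_init : forall a, X a 0 = x0 a ;
  abscissa_lipschitz : forall a s t, 0 <= s -> s <= t -> t <= T ->
    0 <= X a t - X a s <= Vmax * (t - s) ;
  abscissa_ode : {ae @lebesgue_measure R, forall t, 0 < t < T ->
    forall a, has_slope (X a) t (flow (X^~ t) a)}
}.

Lemma valid_abscissas (X : 'I_n -> R) : (forall a, x0 a <= X a) ->
  valid_state N route (roads X) (positions X).
Proof. by move=> xX b; split; [exact: road_at_in|exact: pos_at_interval]. Qed.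

Lemma flow_range (X : 'I_n -> R) a : (forall a, x0 a <= X a) ->
  0 <= flow X a <= Vmax.
Proof.
move=> /valid_abscissas vX.
have /andP[-> /le_trans] := speed_range l_gt0 v_law route_connects a vX.
exact.
Qed.

Section spacing.
Variables (T : R) (X : 'I_n -> R -> R).
Hypothesis X_sol : abscissa_solution T X.

Lemma abscissa_mono a s t : 0 <= s -> s <= t -> t <= T -> X a s <= X a t.
Proof.
move=> s0 st tT; have /andP[] := abscissa_lipschitz X_sol a s0 st tT.
by rewrite subr_ge0.
Qed.

Lemma abscissa_ge_init a t : 0 <= t <= T -> x0 a <= X a t.
Proof.
by move=> /andP[t0 tT]; rewrite -(abscissa_init X_sol a) abscissa_mono.
Qed.

Let valid_at t : 0 <= t <= T -> valid_state N route (roads (X^~ t)) (positions (X^~ t)).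
Proof. by move=> tT; apply: valid_abscissas => a; exact: abscissa_ge_init. Qed.

Let road_index0 a : road_index a (X a 0) = 0%N.
Proof. by rewrite (abscissa_init X_sol a) road_index_x0. Qed.

Definition enters a k s := s = 0 /\ k = 0%N \/
  [/\ 0 < s, (0 < k)%N, X a s = road_start a k &
      forall u, 0 <= u -> u < s -> X a u < road_start a k].

Lemma enters_road a t : 0 <= t <= T -> exists s,
  [/\ 0 <= s, s <= t, enters a (road_index a (X a t)) s &
      forall u, s <= u -> u <= t -> road_index a (X a u) = road_index a (X a t)].
Proof.
move=> /andP[t0 tT]; case kt: (road_index a (X a t)) => [|k].
  exists 0; split => // [|u u0 ut]; first by left.
  by apply/eqP; rewrite -leqn0 -kt road_index_mono // abscissa_mono.
have ks : (k.+1 < size (route a))%N by rewrite -kt road_index_lt.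
have [||||s [s0 st Xs sP]] :=
    @first_nonneg R Vmax (fun u => X a u - road_start a k.+1) 0 t.
- move=> x y x0' xy yt; have yT : y <= T by exact: le_trans tT.
  have /andP[xy0 xyV] := abscissa_lipschitz X_sol a x0' xy yT.
  by rewrite opprB addrA subrK ger0_norm.
- by [].
- rewrite subr_lt0; have := road_index0 a; apply: contra_eqT; rewrite -leNgt.
  by rewrite -road_index_geP // -lt0n; apply: leq_trans.
- by rewrite subr_ge0 road_index_ge.
have Xs' : X a s = road_start a k.+1 by apply/eqP; rewrite -subr_eq0 Xs.
exists s; split => //; first exact: ltW.
  right; split => // u u0 us; rewrite -subr_lt0; exact: sP.
move=> u su ut; apply/eqP; rewrite eqn_leq; apply/andP; split.
  rewrite -kt road_index_mono // abscissa_mono //.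
  exact: le_trans (ltW s0) su.
rewrite road_index_geP // -Xs' abscissa_mono // ?(ltW s0) //.
exact: le_trans ut tT.
Qed.

(* If the speed of [a] vanished on some interval before [s], then [a] would not
   move on that interval and could not reach the next road at [s]. *)
Lemma moving_before a k s h : s <= T -> 0 < h -> 0 < s ->
  (forall u, 0 <= u -> u < s -> X a u < road_start a k) -> X a s = road_start a k ->
  exists u, [/\ 0 < u, s - h < u, u < s & flow (X^~ u) a != 0].
Proof.
move=> sT h0 s0 sP Xs; apply: contrapT => nu.
pose w := Num.max 0 (s - h).
have w0 : 0 <= w by rewrite le_max lexx.
have ws : w < s by rewrite gt_max s0; lra.
have hw : s - h <= w by rewrite le_max lexx orbT.
suff /andP[_] : 0 * (s - w) <= X a s - X a w <= 0 * (s - w).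
  by rewrite mul0r subr_le0 leNgt Xs sP.
apply: (lipschitz_ae_slope_bounds (K := Vmax) (ltW ws)).
  move=> x y wx xy ys; have yT : y <= T by exact: le_trans sT.
  have /andP[? ?] := abscissa_lipschitz X_sol a (le_trans w0 wx) xy yT.
  by rewrite ger0_norm.
apply: ae_imply (abscissa_ode X_sol) => t Xt /andP[wt ts].
have t0 : 0 < t by exact: le_lt_trans wt.
exists 0; first by rewrite lexx.
have /Xt /(_ a) : 0 < t < T by rewrite t0 (lt_le_trans ts).
have -> // : flow (X^~ t) a = 0; apply: contrapT => /eqP ft; apply: nu.
by exists t; split => //; exact: le_lt_trans hw wt.
Qed.

Lemma before_entering a k s h : s <= T -> 0 < h -> 0 < s ->
  (k.+1 < size (route a))%N ->
  (forall u, 0 <= u -> u < s -> X a u < road_start a k.+1) ->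
  X a s = road_start a k.+1 ->
  exists2 d, 0 < d & forall u, 0 < u -> s - d < u -> u < s ->
    road_index a (X a u) = k /\
    road_end N (rd a k) - h < pos_at a (X a u) < road_end N (rd a k).
Proof.
move=> sT h0 s0 ks sP Xs.
(* Being within [g] of the end must imply being on road [k]. A later road has a positive length that
   [g] may not exceed; the first one needs no such limit, and its [road_end] may be [0]. *)
pose g := if k is 0 then h else Num.min h (road_end N (rd a k)).
have g0 : 0 < g.
  rewrite /g; case: k ks {sP Xs g} => // k ks; rewrite lt_min h0.
  have := road_start_lt ks; rewrite (@road_startS a k.+1) ?ltrDl //.
  exact: ltnW.
have gh : g <= h by rewrite /g; case: (k) => // i; rewrite ge_min lexx.
have gk : (0 < k)%N -> g <= road_end N (rd a k).
  by rewrite /g; case: (k) => // i _; rewrite ge_min lexx orbT.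
exists (g / (Vmax + 1)); first by rewrite divr_gt0 // ltr_wpDl.
move=> u u0 us1 us; have Xus := sP u (ltW u0) us.
have /andP[_] := abscissa_lipschitz X_sol a (ltW u0) (ltW us) sT.
rewrite Xs => Xu.
have {}Xu : road_start a k.+1 - g < X a u.
  have : (s - u) * (Vmax + 1) < g by rewrite -ltr_pdivlMr ?ltr_wpDl //; lra.
  have : 0 < s - u by rewrite subr_gt0.
  by lra.
have ks' := ltnW ks.
have sS : road_start a k.+1 = road_start a k + road_end N (rd a k).
  by rewrite road_startS.
have iu : road_index a (X a u) = k.
  by apply: road_index_eq => // /gk; lra.
split => //; rewrite /pos_at iu.
by apply/andP; split; lra.
Qed.

Let end_of_road a k s : s <= T -> 0 < s -> (k.+1 < size (route a))%N ->
  forall u, 0 < u -> u < s -> road_index a (X a u) = k ->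
  road_end N (rd a k) - l <= pos_at a (X a u) < road_end N (rd a k) ->
  at_end N l (road_at a (X a u)) (pos_at a (X a u)).
Proof.
by move=> sT s0 ks u u0 us iu pu; rewrite at_endE /road_at iu (route_not_exit ks).
Qed.

(** The speed rule controls the gap across the junction at moving times before [s], not at [s]. If
    the gap at [s] fell short of [l], take a moving time at which [a] is nearer to the end of its
    road than the shortfall; as [b] only advances, the gap would already be less than [l] at that
    time. *)
Lemma entering_gap a b k s w : s <= T -> 0 <= w -> w < s ->
  (k.+1 < size (route a))%N ->
  (forall u, 0 <= u -> u < s -> X a u < road_start a k.+1) ->
  X a s = road_start a k.+1 ->
  (forall u, w <= u -> u <= s -> road_at b (X b u) = rd a k.+1) ->
  l <= pos_at b (X b s).
Proof.
move=> sT w0 ws ks sP Xs bP; have s0 : 0 < s by exact: le_lt_trans ws.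
rewrite leNgt; apply/negP => bl.
have h0 : 0 < Num.min l (l - pos_at b (X b s)) by rewrite lt_min l_gt0 subr_gt0.
have [d d0 dP] := before_entering sT h0 s0 ks sP Xs.
have e0 : 0 < Num.min d (s - w) by rewrite lt_min d0 subr_gt0.
have [u [u0 us1 us fu]] := moving_before sT e0 s0 sP Xs.
have [du wu] : s - d < u /\ w < u.
  have : s - u < Num.min d (s - w) by lra.
  by rewrite lt_min => /andP[? ?]; split; lra.
have [iu /andP[pu1 pu2]] := dP u u0 du us.
have [hl hb] : road_end N (rd a k) - l < pos_at a (X a u) /\
    road_end N (rd a k) - (l - pos_at b (X b s)) < pos_at a (X a u).
  have : road_end N (rd a k) - pos_at a (X a u) <
    Num.min l (l - pos_at b (X b s)) by lra.
  by rewrite lt_min => /andP[? ?]; split; lra.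
have uT : 0 <= u <= T by rewrite ltW //= (le_trans (ltW us)).
have aend : at_end N l (road_at a (X a u)) (pos_at a (X a u)).
  by apply: (end_of_road sT s0 ks u0 us iu); rewrite ltW.
have [_ next_gap _] :=
  speed_neq0_at_end l_gt0 v_law route_connects (valid_at uT) aend fu.
have := next_gap b; rewrite finset.inE /= next_road_at ?iu // bP ?ltW // eqxx.
move=> /(_ isT); have -> : pos_at b (X b u) = pos_at b (X b s) + (X b u - X b s).
  have -> : pos_at b (X b s) = X b s - road_start b (road_index b (X b u)).
    rewrite /pos_at; congr (_ - road_start b _).
    by rewrite -!index_road_at !bP // ltW.
  by rewrite /pos_at; lra.
have := abscissa_mono b (ltW u0) (ltW us) sT.
by rewrite /road_at iu; lra.
Qed.

(** If the drivers come from different roads, the one without priority moves at some time when the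
    other is already in its last stretch. If they come from the same road, both are within [l] of
    its end, against the spacing there, which is the last hypothesis. *)
Lemma not_entering_together a b k k' s : s <= T -> 0 < s -> a != b ->
  (k.+1 < size (route a))%N -> (k'.+1 < size (route b))%N ->
  rd a k.+1 = rd b k'.+1 ->
  (forall u, 0 <= u -> u < s -> X a u < road_start a k.+1) ->
  X a s = road_start a k.+1 ->
  (forall u, 0 <= u -> u < s -> X b u < road_start b k'.+1) ->
  X b s = road_start b k'.+1 ->
  (forall u, 0 < u -> u < s -> road_index a (X a u) = k ->
    road_at a (X a u) = road_at b (X b u) ->
    l <= `|pos_at a (X a u) - pos_at b (X b u)|) ->
  False.
Proof.
move=> sT s0 ab ks k's kk' sPa Xas sPb Xbs IH.
have [d d0 dP] := before_entering sT l_gt0 s0 ks sPa Xas.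
have [d' d'0 d'P] := before_entering sT l_gt0 s0 k's sPb Xbs.
have e0 : 0 < Num.min d d' by rewrite lt_min d0 d'0.
have near u : s - Num.min d d' < u -> s - d < u /\ s - d' < u.
  move=> su; have : s - u < Num.min d d' by lra.
  by rewrite lt_min => /andP[? ?]; split; lra.
have ee : ends N (rd a k) = ends N (rd b k').
  have /andP[_ /eqP ->] := elimT (sortedP (r0 a)) (route_valid a) k ks.
  have /andP[_ /eqP ->] := elimT (sortedP (r0 b)) (route_valid b) k' k's.
  by rewrite kk'.
have [u [u0 us1 us fu]] := moving_before sT e0 s0 sPa Xas.
have [u' [u'0 u's1 u's fu']] := moving_before sT e0 s0 sPb Xbs.
have [du d'u] := near u us1; have [du' d'u'] := near u' u's1.
have [iau /andP[pau1 pau2]] := dP u u0 du us.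
have [ibu /andP[pbu1 pbu2]] := d'P u u0 d'u us.
have [iau' /andP[pau'1 pau'2]] := dP u' u'0 du' u's.
have [ibu' /andP[pbu'1 pbu'2]] := d'P u' u'0 d'u' u's.
have uT : 0 <= u <= T by rewrite ltW //= (le_trans (ltW us)).
have u'T : 0 <= u' <= T by rewrite ltW //= (le_trans (ltW u's)).
have aend : at_end N l (road_at a (X a u)) (pos_at a (X a u)).
  by apply: (end_of_road sT s0 ks u0 us iau); rewrite ltW.
have bend : at_end N l (road_at b (X b u')) (pos_at b (X b u')).
  by apply: (end_of_road sT s0 k's u'0 u's ibu'); rewrite ltW.
have [_ _ ya] := speed_neq0_at_end l_gt0 v_law route_connects (valid_at uT) aend fu.
have [_ _ yb] := speed_neq0_at_end l_gt0 v_law route_connects (valid_at u'T) bend fu'.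
have [jj|jj|jj] := ltngtP (rd a k) (rd b k').
- have /negP := yb a; apply; rewrite /yields /road_at iau' ibu' ee eqxx jj /=.
  exact: ltW.
- have /negP := ya b; apply; rewrite /yields /road_at iau ibu ee eqxx jj /=.
  exact: ltW.
- have jE : rd a k = rd b k' by exact: val_inj.
  have := IH u u0 us iau; rewrite /road_at iau ibu => /(_ jE); rewrite leNgt => /negP.
  by apply; rewrite -jE in pbu1 pbu2; apply/ltr_normlP; split; lra.
Qed.

(** After the last time [c] at which the gap equals [l], the follower [a] is too close to [b] and
    stands still, while [b] does not move backwards. So the gap cannot decrease after [c]. *)
Lemma gap_persists a b s t : 0 <= s -> s <= t -> t <= T ->
  (forall u, s <= u -> u <= t -> road_index a (X a u) = road_index a (X a t)) ->
  (forall u, s <= u -> u <= t -> road_index b (X b u) = road_index b (X b t)) ->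
  road_at a (X a t) = road_at b (X b t) ->
  pos_at a (X a s) + l <= pos_at b (X b s) ->
  pos_at a (X a t) + l <= pos_at b (X b t).
Proof.
move=> s0 st tT ia ib rab gs.
pose f u := pos_at b (X b u) - pos_at a (X a u) - l.
have fE u w : s <= u -> u <= t -> s <= w -> w <= t ->
    f u - f w = (X b u - X b w) - (X a u - X a w).
  by move=> su ut sw wt; rewrite /f /pos_at !(ia u, ia w, ib u, ib w) //; lra.
have fK : lipschitz_between (Vmax + Vmax) f s t.
  move=> x y sx xy yt; have xs0 := le_trans s0 sx; have yT := le_trans yt tT.
  have /andP[? ?] := abscissa_lipschitz X_sol a xs0 xy yT.
  have /andP[? ?] := abscissa_lipschitz X_sol b xs0 xy yT.
  rewrite fE //; [|exact: le_trans xy|exact: le_trans yt].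
  by apply/ler_normlP; split; lra.
suff : 0 <= f t by rewrite /f; lra.
rewrite leNgt; apply/negP => ft.
have fs : 0 <= f s by rewrite /f; lra.
have [c [sc ct fc cP]] := last_nonneg fK st fs ft.
(* Up to [w] the gap loses less than [l], so [b] is still strictly ahead of [a], as
   [speed_eq0_close] requires. *)
pose w := Num.min t (c + l / (Vmax + Vmax + 1)).
have D0 : 0 < Vmax + Vmax + 1 by rewrite ltr_wpDl // addr_ge0.
have cw : c < w by rewrite lt_min ct ltrDl divr_gt0.
have wt : w <= t by rewrite ge_min lexx.
have fl u : c < u -> u <= w -> - l < f u.
  move=> cu uw; have ut := le_trans uw wt.
  have /ler_normlP[+ _] := fK _ _ sc (ltW cu) ut; rewrite fc.
  have : (u - c) * (Vmax + Vmax + 1) <= l.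
    rewrite -ler_pdivlMr // lerBlDl; apply: le_trans uw _.
    by rewrite ge_min lexx orbT.
  by lra.
have := cP w cw wt; rewrite ltNge => /negP; apply.
suff /andP[+ _] : 0 * (w - c) <= f w - f c <= Vmax * (w - c).
  by rewrite mul0r fc subr0.
apply: (lipschitz_ae_slope_bounds (K := Vmax + Vmax) (ltW cw)).
- by move=> x y cx xy yw; apply: fK => //; [exact: le_trans cx|exact: le_trans wt].
- apply: ae_imply (abscissa_ode X_sol) => u Xu /andP[cu uw].
  have u0 : 0 < u by apply: le_lt_trans cu; exact: le_trans sc.
  have ut : u < t by exact: lt_le_trans wt.
  have uT : u < T by exact: lt_le_trans tT.
  have uT' : 0 <= u <= T by rewrite !ltW.
  have su : s <= u by exact/ltW/(le_lt_trans sc).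
  have fa0 : flow (X^~ u) a = 0.
    apply: (speed_eq0_close l_gt0 v_law route_connects (valid_at uT') (b := b)).
    - by move: rab; rewrite /road_at ia ?ib // ltW.
    - by have := fl u cu (ltW uw); rewrite /f; lra.
    - by have := cP u cu (ltW ut); rewrite /f; lra.
  exists (flow (X^~ u) b - flow (X^~ u) a).
    rewrite fa0 subr0; apply: flow_range => a'; exact: abscissa_ge_init.
  have k0 : 0 < Num.min (u - c) (w - u) by rewrite lt_min !subr_gt0 cu.
  have Xu' : 0 < u < T by rewrite u0.
  apply: near_has_slope k0 _ (has_slopeB (Xu Xu' b) (Xu Xu' a)) => z.
  rewrite lt_min => /andP[/ltr_normlP[z1 _] /ltr_normlP[_ z2]].
  by rewrite fE //; lra.
Qed.

(** The spacing is established when the later of the two drivers enters the common road, then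
    persists. The induction is on the road index of [a], the index of [b] being free; the hypothesis
    is called only to exclude a simultaneous entrance, on the road of [a] just before. *)
Lemma abscissa_solution_spaced t : 0 <= t <= T -> spaced (X^~ t).
Proof.
suff H k : forall a b t, 0 <= t <= T -> a != b -> road_index a (X a t) = k ->
    road_at a (X a t) = road_at b (X b t) ->
    l <= `|pos_at a (X a t) - pos_at b (X b t)|.
  by move=> tT a b ab; exact: H tT ab erefl.
elim/ltn_ind: k => k IH {}a b {}t tT ab kE rab; have /andP[t0 tT'] := tT.
have [s [s0 st sa sP]] := enters_road a tT.
have [s' [s'0 s't sb s'P]] := enters_road b tT.
(* It is not known which driver is in front, so the gap is propagated in both orders. *)
have persist w : s <= w -> s' <= w -> w <= t ->
    l <= `|pos_at a (X a w) - pos_at b (X b w)| ->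
    l <= `|pos_at a (X a t) - pos_at b (X b t)|.
  move=> sw s'w wt; have w0 := le_trans s0 sw.
  have iaw u : w <= u -> u <= t -> road_index a (X a u) = road_index a (X a t).
    by move=> wu ut; apply: sP => //; exact: le_trans wu.
  have ibw u : w <= u -> u <= t -> road_index b (X b u) = road_index b (X b t).
    by move=> wu ut; apply: s'P => //; exact: le_trans wu.
  have := gap_persists w0 wt tT' iaw ibw rab.
  have := gap_persists w0 wt tT' ibw iaw (esym rab).
  by rewrite !ler_normr => ba ab' /orP[] H; apply/orP; [left|right]; lra.
have at_s u : s <= u -> u <= t -> road_at a (X a u) = road_at a (X a t).
  by move=> su ut; rewrite /road_at sP.
have at_s' u : s' <= u -> u <= t -> road_at b (X b u) = road_at b (X b t).
  by move=> su ut; rewrite /road_at s'P.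
case: sa => [[sE ka]|[s_gt0]]; case: sb => [[s'E kb]|[s'_gt0]].
- apply: (persist 0); rewrite ?sE ?s'E //.
  rewrite !(abscissa_init X_sol) !(x0_decode _).2; apply: x0_spaced => //.
  by move: rab; rewrite /road_at ka kb !route_nth0.
- case kb: (road_index b (X b t)) => [//|k'] _ Xb Xb'.
  apply: (persist s'); rewrite ?sE //; rewrite -?sE.
  have kbs : (k'.+1 < size (route b))%N by rewrite -kb road_index_lt.
  have := @entering_gap b a k' s' 0 (le_trans s't tT') (lexx 0) s'_gt0 kbs Xb' Xb.
  have -> : pos_at b (X b s') = 0 by rewrite /pos_at s'P // kb Xb subrr.
  rewrite subr0 ler_normr => -> // u u0 us'.
  by rewrite at_s ?sE // ?(le_trans us') // rab /road_at kb.
- case ka: (road_index a (X a t)) => [//|k'] _ Xa Xa'.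
  apply: (persist s); rewrite ?s'E //.
  have kas : (k'.+1 < size (route a))%N by rewrite -ka road_index_lt.
  have := @entering_gap a b k' s 0 (le_trans st tT') (lexx 0) s_gt0 kas Xa' Xa.
  have -> : pos_at a (X a s) = 0 by rewrite /pos_at sP // ka Xa subrr.
  rewrite sub0r normrN ler_normr => -> // u u0 us'.
  by rewrite at_s' ?s'E // ?(le_trans us') // -rab /road_at ka.
- case kb: (road_index b (X b t)) => [//|k'] _ Xb Xb'.
  case ka: (road_index a (X a t)) => [//|i] _ Xa Xa'.
  have kas : (i.+1 < size (route a))%N by rewrite -ka road_index_lt.
  have kbs : (k'.+1 < size (route b))%N by rewrite -kb road_index_lt.
  have rE : rd a i.+1 = rd b k'.+1 by move: rab; rewrite /road_at ka kb.
  have sT := le_trans st tT'; have s'T := le_trans s't tT'.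
  have [ss'|ss'|ss'] := ltgtP s s'.
  + apply: (persist s') => //; first exact: ltW.
    have := @entering_gap b a k' s' s s'T s0 ss' kbs Xb' Xb.
    have -> : pos_at b (X b s') = 0 by rewrite /pos_at s'P // kb Xb subrr.
    rewrite subr0 ler_normr => -> // u u0 us'.
    by rewrite at_s ?(le_trans us') // rab /road_at kb.
  + apply: (persist s) => //; first exact: ltW.
    have := @entering_gap a b i s s' sT s'0 ss' kas Xa' Xa.
    have -> : pos_at a (X a s) = 0 by rewrite /pos_at sP // ka Xa subrr.
    rewrite sub0r normrN ler_normr => -> // u u0 us.
    by rewrite at_s' ?(le_trans us) // -rab /road_at ka.
  + subst s'; exfalso.
    apply: (not_entering_together sT s_gt0 ab kas kbs rE Xa' Xa Xb' Xb).
    move=> u u0 us iu; apply: (IH i) => //; first by rewrite -kE ka.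
    by rewrite ltW //= (le_trans (ltW us)).
Qed.

End spacing.

(** * Uniqueness *)

Lemma flow_right (X : 'I_n -> R) : (forall a, x0 a <= X a) -> spaced X ->
  exists e G K, [/\ 0 < e, 0 <= K, forall Y a, 0 <= G Y a <= Vmax,
    forall Y Y' d a, (forall b, `|Y b - Y' b| <= d) -> `|G Y a - G Y' a| <= K * d &
    forall Y, (forall b, X b <= Y b < X b + e) -> forall a, flow Y a = G Y a].
Proof.
move=> xX Xsp; have vX := valid_abscissas xX.
have sepX a b : a != b -> road_at a (X a) = road_at b (X b) ->
    pos_at a (X a) != pos_at b (X b).
  move=> ab rab; apply/eqP => pab; have := Xsp a b ab rab.
  by rewrite pab subrr normr0 leNgt l_gt0.
have [e1 e10 e1P] := speed_right_frozen l_gt0 v_law route_connects vX sepX.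
have /choice[h hP] : forall b, exists h, 0 < h /\
    forall Y, X b <= Y < X b + h -> road_index b Y = road_index b (X b).
  by move=> b; have [h h0 hP] := road_index_right b (X b); exists h.
have [e2 e20 e2P] := pos_lower_bound h.
have [K K0 KP] := frozen_speed_lipschitz N route l_gt0 v_law.
pose o b := road_start b (road_index b (X b)).
exists (Num.min e1 e2), (fun Y a => frozen_speed N l V v route (roads X)
  (positions X) a (fun b => Y b - o b)), K.
split => //; first by rewrite lt_min e10.
- move=> Y a; have /andP[-> /le_trans] := frozen_speed_range N route l_gt0 v_law
    (roads X) (positions X) a (fun b => Y b - o b).
  by apply.
- move=> Y Y' d a YY'; apply: KP => b.
  by have -> : Y b - o b - (Y' b - o b) = Y b - Y' b by lra.
- move=> Y XY a; have iY b : road_index b (Y b) = road_index b (X b).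
    have [h0 hb] := hP b; apply: hb; have /andP[-> /=] := XY b.
    by rewrite -ltrBlDl lt_min => /andP[_ Ye]; have := e2P b h0; lra.
  have rY : roads Y = roads X by apply/funext => b; rewrite /road_at iY.
  have pY : positions Y = (fun b => Y b - o b).
    by apply/funext => b; rewrite /pos_at iY.
  rewrite /flow rY pY; apply: (e1P _ _).2 => b.
  have /andP[XYb] := XY b; rewrite -ltrBlDl lt_min => /andP[Ye _].
  by rewrite /pos_at -/(o b); apply/andP; split; lra.
Qed.

Lemma abscissa_norm T X a s t : abscissa_solution T X -> 0 <= s -> s <= t -> t <= T ->
  `|X a t - X a s| <= Vmax * (t - s).
Proof.
move=> XT s0 st tT; have /andP[? ?] := abscissa_lipschitz XT a s0 st tT.
by rewrite ger0_norm.
Qed.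

Lemma abscissa_solution_unique T X X' : abscissa_solution T X ->
  abscissa_solution T X' -> forall t, 0 <= t <= T -> forall a, X a t = X' a t.
Proof.
move=> XT X'T.
have VV0 : 0 < Vmax + Vmax + 1 by rewrite ltr_wpDl // addr_ge0.
have dist_le s t a : 0 <= s -> s <= t -> t <= T -> X a s = X' a s ->
    `|X a t - X' a t| <= (Vmax + Vmax + 1) * (t - s).
  move=> s0 st tT Xs.
  have /andP[? ?] := abscissa_lipschitz XT a s0 st tT.
  have /andP[? ?] := abscissa_lipschitz X'T a s0 st tT.
  have ? : 0 <= t - s by rewrite subr_ge0.
  by apply/ler_normlP; split; lra.
apply: (@real_induction _ 0 T (fun t => forall a, X a t = X' a t)) => t /andP[t0 tT].
  move=> Xt a; have [->|t0'] := eqVneq t 0.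
    by rewrite (abscissa_init XT) (abscissa_init X'T).
  have {t0'} t_gt0 : 0 < t by rewrite lt_neqAle eq_sym t0'.
  apply/eqP; rewrite -subr_eq0 -normr_le0; apply/ler_addgt0Pr => e e0; rewrite add0r.
  pose s := Num.max 0 (t - e / (Vmax + Vmax + 1)).
  have s0 : 0 <= s by rewrite le_max lexx.
  have st : s < t by rewrite gt_max t_gt0 gtrBl divr_gt0.
  have Xs : X a s = X' a s by apply: Xt; rewrite s0.
  apply: le_trans (dist_le s t a s0 (ltW st) tT Xs) _.
  rewrite mulrC -ler_pdivlMr // lerBlDr -lerBlDl.
  by rewrite /s le_max lexx orbT.
move=> Xt; have {}Xt : forall a, X a t = X' a t by apply: Xt; rewrite t0 lexx.
have tT' : 0 <= t <= T by rewrite t0 ltW.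
have := @flow_right (X^~ t) (fun a => abscissa_ge_init XT a tT')
  (abscissa_solution_spaced XT tT').
case=> e [G [K [e0 K0 Grange Glip GP]]].
have K10 : 0 < K + 1 by rewrite ltr_wpDl.
have V10 : 0 < Vmax + 1 by rewrite ltr_wpDl.
(* The three terms keep the time below [T], keep both solutions in the box where the flow is [G],
   and make [K * d] at most [1 / 2]. *)
pose d := Num.min (T - t) (Num.min (e / (Vmax + 1)) (2 * (K + 1))^-1).
have d0 : 0 < d by rewrite !lt_min subr_gt0 tT divr_gt0 //= invr_gt0 mulr_gt0.
have [dT de dK] : [/\ d <= T - t, d <= e / (Vmax + 1) & d <= (2 * (K + 1))^-1].
  by rewrite /d; split; rewrite !ge_min lexx ?orbT.
have Kd : K * d <= 1 / 2.
  apply: le_trans (_ : K * (2 * (K + 1))^-1 <= _); first by rewrite ler_wpM2l.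
  rewrite ler_pdivrMr ?mulr_gt0 //; lra.
exists d => // u /andP[tu ud] a.
(* The largest distance over all drivers and all times in [[t, t + d]] is finite by the speed bound,
   and will be at most half of itself. *)
pose S := [set z | exists b w, [/\ t <= w, w <= t + d & z = `|X b w - X' b w|]].
have Sbound b w : t <= w -> w <= t + d -> `|X b w - X' b w| <= (Vmax + Vmax + 1) * d.
  move=> tw wd; have wT : w <= T by lra.
  apply: le_trans (dist_le _ _ b t0 tw wT (Xt b)) _.
  by rewrite ler_wpM2l ?(ltW VV0) //; lra.
have S_sup : has_sup S.
  split; first by exists `|X a u - X' a u|, a, u; split => //; exact: ltW.
  by exists ((Vmax + Vmax + 1) * d) => _ [b [w [tw wd ->]]]; exact: Sbound.
have le_sup b w : t <= w -> w <= t + d -> `|X b w - X' b w| <= sup S.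
  by move=> tw wd; apply: ub_le_sup; [case: S_sup|exists b, w].
have sup0 : 0 <= sup S by apply: le_trans (le_sup a u (ltW tu) (ltW ud)).
have near_t (Z : 'I_n -> R -> R) : abscissa_solution T Z -> (forall b, Z b t = X b t) ->
    forall w, t < w -> w < t + d -> forall b, flow (Z^~ w) b = G (Z^~ w) b.
  move=> ZT Zt w tw wd; apply: GP => b.
  have wT : w <= T by lra.
  have /andP[] := abscissa_lipschitz ZT b t0 (ltW tw) wT; rewrite Zt subr_ge0 => -> /=.
  have : (w - t) * (Vmax + 1) < e by rewrite -ltr_pdivlMr //; apply: lt_le_trans de; lra.
  by lra.
have contract b w : t <= w -> w <= t + d -> `|X b w - X' b w| <= sup S / 2.
  move=> tw wd; have wT : w <= T by lra.
  suff : - (K * sup S) * (w - t) <= (X b w - X' b w) - (X b t - X' b t) <=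
      K * sup S * (w - t).
    rewrite Xt subrr subr0 mulNr -ler_norml => /le_trans; apply.
    have wtd : K * (w - t) <= 1 / 2 by apply: le_trans Kd; rewrite ler_wpM2l //; lra.
    by have := ler_wpM2l sup0 wtd; lra.
  apply: (@lipschitz_ae_slope_bounds _ (fun w => X b w - X' b w)
    _ _ (Vmax + Vmax)) => //.
    move=> p q tp pq qw; have p0 := le_trans t0 tp; have qT := le_trans qw wT.
    have /andP[? ?] := abscissa_lipschitz XT b p0 pq qT.
    have /andP[? ?] := abscissa_lipschitz X'T b p0 pq qT.
    by apply/ler_normlP; split; lra.
  apply: ae_imply2 (abscissa_ode XT) (abscissa_ode X'T) => p Xp X'p /andP[tp pw].
  have pT : 0 < p < T by rewrite (le_lt_trans t0) //= (lt_le_trans pw).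
  have pd : p < t + d by lra.
  exists (flow (X^~ p) b - flow (X'^~ p) b); last by apply: has_slopeB; auto.
  rewrite -ler_norml !near_t //; apply: Glip => c.
  by apply: le_sup; [exact: ltW|exact: ltW].
have : sup S <= sup S / 2.
  by apply: ge_sup; [case: S_sup|move=> _ [b [w [tw wd ->]]]; exact: contract].
move=> sup_half; have := le_sup a u (ltW tu) (ltW ud).
move=> H; apply/eqP; rewrite -subr_eq0 -normr_le0; lra.
Qed.

(** * Existence *)

Lemma abscissa_solution_eq T X Y : abscissa_solution T X -> 0 <= T ->
  (forall a t, 0 <= t <= T -> Y a t = X a t) -> abscissa_solution T Y.
Proof.
move=> XT T0 YX; split.
- by move=> a; rewrite YX ?lexx // (abscissa_init XT).
- move=> a s t s0 st tT; have t0 := le_trans s0 st; have sT := le_trans st tT.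
  by rewrite !YX ?s0 ?t0 //; exact: abscissa_lipschitz XT a s t s0 st tT.
- apply: ae_imply (abscissa_ode XT) => t Xt tT a; have /andP[t0 tT'] := tT.
  have -> : Y^~ t = X^~ t by apply/funext => b; rewrite YX // !ltW.
  apply: (@near_has_slope _ (X a) _ _ _ (Num.min t (T - t))); last exact: Xt.
    by rewrite lt_min t0 subr_gt0.
  move=> u; rewrite lt_min => /andP[/ltr_normlP[u1 _] /ltr_normlP[_ u2]].
  by rewrite !YX // !ltW //; lra.
Qed.

Lemma abscissa_solution_restrict T T' X : T' <= T -> abscissa_solution T X ->
  abscissa_solution T' X.
Proof.
move=> T'T XT; split; first exact: abscissa_init XT.
- by move=> a s t s0 st tT'; apply: (abscissa_lipschitz XT) => //; exact: le_trans T'T.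
- apply: ae_imply (abscissa_ode XT) => t Xt /andP[t0 tT']; apply: Xt.
  by rewrite t0 (lt_le_trans tT').
Qed.

Lemma abscissa_solution_extend T X : 0 <= T -> abscissa_solution T X ->
  exists2 d, 0 < d & exists X', abscissa_solution (T + d) X'.
Proof.
move=> T0 XT; have TT : 0 <= T <= T by rewrite T0 lexx.
have [e [G [K [e0 K0 Grange Glip GP]]]] := @flow_right (X^~ T)
  (fun a => abscissa_ge_init XT a TT) (abscissa_solution_spaced XT TT).
have [d d0 [Y [Y0 Ylip Yode]]] := picard Vmax_ge0 K0 Grange Glip (X^~ T).
have V10 : 0 < Vmax + 1 by rewrite ltr_wpDl.
(* Moving at speed at most [Vmax], the new piece stays before [e / (Vmax + 1)] in the box where [G]
   is the flow. *)
pose c := Num.min d (e / (Vmax + 1)).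
have c0 : 0 < c by rewrite lt_min d0 divr_gt0.
have [cd ce] : c <= d /\ c <= e / (Vmax + 1) by rewrite !ge_min !lexx orbT.
exists c => //; exists (fun a t => if t <= T then X a t else Y a (t - T)); split.
- by move=> a; rewrite T0 (abscissa_init XT).
- move=> a s t s0 st tTc; case: (leP t T) => [tT|Tt].
    by rewrite (le_trans st tT); exact: abscissa_lipschitz XT a s t s0 st tT.
  case: (leP s T) => [sT|Ts]; last first.
    have -> : t - s = t - T - (s - T) by lra.
    by apply: Ylip; lra.
  have /andP[? ?] := abscissa_lipschitz XT a s0 sT (lexx T).
  have : 0 <= Y a (t - T) - Y a 0 <= Vmax * (t - T - 0) by apply: Ylip; lra.
  by rewrite Y0 => /andP[? ?]; apply/andP; split; lra.
(* The gluing time [T] is discarded, since the two pieces may meet there with different slopes. *)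
- apply: ae_imply2 (abscissa_ode XT) (ae_notin_set1 T) => t Xt tT /andP[t0 tTc] a.
  have [tT'|Tt] := ltP t T.
    have -> : (fun b => if t <= T then X b t else Y b (t - T)) = X^~ t.
      by rewrite ltW.
    apply: (@near_has_slope _ (X a) _ _ _ (T - t)); rewrite ?subr_gt0 //.
      move=> u /ltr_normlP[_ uT]; have uT' : u <= T by lra.
      by rewrite uT' ltW.
    by apply: Xt; rewrite t0.
  have {tT}Tt : T < t by rewrite lt_neqAle eq_sym tT.
  have -> : (fun b => if t <= T then X b t else Y b (t - T)) = Y^~ (t - T).
    by apply/funext => b; rewrite leNgt Tt.
  apply: (@near_has_slope _ (fun u => Y a (u - T)) _ _ _ (t - T)).
  + by rewrite subr_gt0.
  + move=> u /ltr_normlP[uT _]; have uT' : T < u by lra.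
    by rewrite !leNgt uT' Tt.
  + have YG : flow (Y^~ (t - T)) a = G (Y^~ (t - T)) a.
      apply: GP => b.
      have : 0 <= Y b (t - T) - Y b 0 <= Vmax * (t - T - 0) by apply: Ylip; lra.
      rewrite Y0 subr0 subr_ge0 => /andP[-> /=].
      have : (t - T) * (Vmax + 1) < e.
        by rewrite -ltr_pdivlMr //; apply: lt_le_trans ce; lra.
      by lra.
    have Ytd : 0 < t - T < d by apply/andP; split; lra.
    rewrite YG => z /(Yode a _ Ytd)[h h0 hP]; exists h => // u uh.
    have := hP (u - T); have -> : u - T - (t - T) = u - t by lra.
    exact.
Qed.

Lemma abscissa_solution0 : abscissa_solution 0 (fun a _ => x0 a).
Proof.
split => // [a s t s0 st t0|]; first by rewrite subrr lexx mulr_ge0 //; lra.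
by apply: aeW => t /andP[t0 /(lt_trans t0)]; rewrite ltxx.
Qed.

Definition solvable_until (T : R) := 0 <= T /\ exists X, abscissa_solution T X.

(* Two solutions agree on their common interval and the abscissas are
   nondecreasing, so this supremum glues all the solutions together, and it also
   provides the limit at the end of their common interval. *)
Definition glued (a : 'I_n) (t : R) : R :=
  sup [set y | exists T X s,
    [/\ abscissa_solution T X, 0 <= s, s <= t, s <= T & y = X a s]].

Let glued_has_sup a t : 0 <= t -> has_sup [set y | exists T X s,
    [/\ abscissa_solution T X, 0 <= s, s <= t, s <= T & y = X a s]].
Proof.
move=> t0; split.
  exists (x0 a), 0, (fun a _ => x0 a), 0; split => //.
  exact: abscissa_solution0.
exists (x0 a + Vmax * t) => _ [T [X [s [XT s0 st sT ->]]]].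
have /andP[_] := abscissa_lipschitz XT a (lexx 0) s0 sT.
rewrite (abscissa_init XT) subr0 lerBlDl => /le_trans; apply.
by rewrite lerD2l ler_wpM2l.
Qed.

Lemma glued_eq T X : abscissa_solution T X ->
  forall a t, 0 <= t <= T -> glued a t = X a t.
Proof.
move=> XT a t /andP[t0 tT]; apply/eqP; rewrite eq_le; apply/andP; split.
  apply: ge_sup; first by case: (glued_has_sup a t0).
  move=> _ [T' [X' [s [X'T' s0 st sT' ->]]]].
  have ss : 0 <= s <= s by rewrite s0 lexx.
  have -> : X' a s = X a s.
    apply: (abscissa_solution_unique _ _ ss).
      exact: abscissa_solution_restrict X'T'.
    exact: abscissa_solution_restrict (le_trans st tT) XT.
  exact: (abscissa_mono XT).
by apply: ub_le_sup; [case: (glued_has_sup a t0)|exists T, X, t].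
Qed.

Lemma glued_solution T : solvable_until T -> abscissa_solution T glued.
Proof.
move=> [T0 [X XT]]; apply: (abscissa_solution_eq XT T0) => a t tT.
exact: glued_eq XT a t tT.
Qed.

(** Only the earlier time is assumed solvable. This yields the estimate up to the supremum of the
    solvable times, where no solution is known yet. *)
Lemma glued_lipschitz a s t : solvable_until s -> s <= t ->
  0 <= glued a t - glued a s <= Vmax * (t - s).
Proof.
move=> [s0 [X Xs]] st; have t0 := le_trans s0 st.
have ss : 0 <= s <= s by rewrite s0 lexx.
rewrite (glued_eq Xs a ss) subr_ge0 lerBlDl; apply/andP; split.
  by apply: ub_le_sup; [case: (glued_has_sup a t0)|exists s, X, s].
apply: ge_sup; first by case: (glued_has_sup a t0).
move=> _ [T' [Y [w [YT' w0 wt wT' ->]]]].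
have Yw : abscissa_solution w Y by exact: abscissa_solution_restrict YT'.
have ww : 0 <= w <= w by rewrite w0 lexx.
have ? : 0 <= Vmax * (t - w) by rewrite mulr_ge0 // subr_ge0.
have [ws|/ltW sw] := leP w s.
  have Xw : abscissa_solution w X by exact: abscissa_solution_restrict Xs.
  rewrite (abscissa_solution_unique Yw Xw ww).
  have := abscissa_mono Xs a w0 ws (lexx s).
  have : 0 <= Vmax * (t - s) by rewrite mulr_ge0 // subr_ge0.
  by lra.
have Ys : abscissa_solution s Y by exact: abscissa_solution_restrict Yw.
have /andP[_] := abscissa_lipschitz Yw a s0 sw (lexx w).
by rewrite (abscissa_solution_unique Ys Xs ss); lra.
Qed.

Lemma solvable T : 0 <= T -> solvable_until T.
Proof.
move=> T0; apply: contrapT => nT.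
have down s t : 0 <= s -> s <= t -> solvable_until t -> solvable_until s.
  move=> s0 st [_ [X Xt]]; split => //; exists X.
  exact: abscissa_solution_restrict Xt.
have ubT : ubound solvable_until T.
  move=> t St; rewrite leNgt; apply/negP => /ltW Tt; apply: nT.
  exact: down Tt St.
have S0 : solvable_until 0.
  by split => //; exists (fun a _ => x0 a); exact: abscissa_solution0.
have supS : has_sup solvable_until by split; [exists 0|exists T].
set Z := sup solvable_until.
have Z0 : 0 <= Z by apply: ub_le_sup => //; case: supS.
have ltZ t : 0 <= t -> t < Z -> solvable_until t.
  move=> t0 tZ; have /(sup_adherent) : 0 < Z - t by rewrite subr_gt0.
  move=> /(_ _ supS)[s Ss]; rewrite subKr => /ltW ts.
  exact: down ts Ss.
have ZT : abscissa_solution Z glued.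
  split.
  - by move=> a; rewrite (abscissa_init (glued_solution S0)).
  - move=> a s t s0 st tZ; have [sZ|Zs] := ltP s Z.
      by apply: glued_lipschitz => //; exact: ltZ.
    have -> : s = t by apply/eqP; rewrite eq_le st (le_trans tZ).
    by rewrite !subrr mulr0 lexx.
  (* Below the supremum [Z] the equation is known on each shorter interval; countably many of them
     exhaust []0, Z[], so the exceptional sets still form a null set. *)
  - have /ae_forall_nat : forall i : nat, {ae @lebesgue_measure R, forall t,
        0 < t < Z - i.+1%:R^-1 -> forall a, has_slope (glued a) t (flow (glued^~ t) a)}.
      move=> i; have [Zi|Zi] := leP 0 (Z - i.+1%:R^-1).
        apply: abscissa_ode (glued_solution (ltZ _ Zi _)).
        by rewrite gtrBl invr_gt0.
      by apply: aeW => t /andP[t0 /(lt_trans t0)]; rewrite ltNge ltW.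
    apply: ae_imply => t gt /andP[t0 tZ].
    have Zt : 0 < Z - t by rewrite subr_gt0.
    apply: (gt (Num.bound (Z - t)^-1)); rewrite t0 /=.
    have Zt0 : 0 < (Z - t)^-1 by rewrite invr_gt0.
    have := archi_boundP (ltW Zt0); set b := Num.bound _ => bP.
    rewrite ltrBrDr -ltrBrDl.
    rewrite invf_plt ?posrE // (lt_trans bP) // ltr_nat //.
have [d d0 [X Xd]] := abscissa_solution_extend Z0 ZT.
have : Z + d <= Z.
  by apply: ub_le_sup; [case: supS|split; [lra|exists X]].
lra.
Qed.

Lemma global_abscissa_solution : exists X, forall T, 0 <= T -> abscissa_solution T X.
Proof. by exists glued => T T0; apply: glued_solution; exact: solvable. Qed.

(** * Roads and positions from abscissas *)

Lemma within_continuous_dist (f : R -> R) :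
  {within [set` `[0, +oo[ : interval R], continuous f} <->
  forall x, 0 <= x -> forall e, 0 < e -> exists2 h, 0 < h &
    forall u, 0 <= u -> `|u - x| < h -> `|f u - f x| <= e.
Proof.
split=> [/subspace_continuousP fc x x_ge0 e e0|fc].
  have := fc x; rewrite /= in_itv /= x_ge0 => /(_ isT) /cvgrPdist_le /(_ e e0).
  move=> /itv_nbhs[h h0 hP]; exists h => // u u0 /hP; rewrite /= in_itv /= u0.
  by move=> /(_ isT); rewrite distrC.
apply/subspace_continuousP => x; rewrite /= in_itv /= andbT => x_ge0.
apply/cvgrPdist_le => e e0; have [h h0 hP] := fc x x_ge0 e e0.
apply/itv_nbhs; exists h => // u ux; rewrite /= in_itv /= andbT => u0.
by rewrite distrC; exact: hP.
Qed.

(** At most one point is excluded: the least element of [P] in [[0, +oo[], if it exists. *)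
Lemma ae_not_first (P : R -> Prop) : {ae @lebesgue_measure R, forall t,
  0 <= t -> P t -> exists2 u, 0 <= u < t & P u}.
Proof.
have [[c [c0 Pc cP]]|nc] := pselect (exists c, [/\ 0 <= c, P c &
    forall u, 0 <= u < c -> ~ P u]).
  apply: ae_imply (ae_notin_set1 c) => t tc t0 Pt.
  have [tltc|ct] := ltP t c; first by exfalso; apply: (cP t) => //; rewrite t0.
  by exists c => //; rewrite c0 lt_neqAle eq_sym tc.
apply: aeW => t t0 Pt; apply: contrapT => nu; apply: nc; exists t; split => //.
by move=> u ut Pu; apply: nu; exists u.
Qed.

(** A jump at a positive time is the first time at which some level [k] is reached, and there are
    countably many levels. *)
Lemma ae_step_constant (i : R -> nat) :
  (forall s t, 0 <= s -> s <= t -> (i s <= i t)%N) ->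
  (forall t, 0 <= t -> exists2 h, 0 < h & forall u, t < u < t + h -> i u = i t) ->
  {ae @lebesgue_measure R, forall t, 0 < t ->
    exists2 h, 0 < h & forall u, `|u - t| < h -> 0 <= u /\ i u = i t}.
Proof.
move=> i_mono i_right.
have : {ae @lebesgue_measure R, forall t, forall k : nat, 0 <= t -> (k <= i t)%N ->
    exists2 u, 0 <= u < t & (k <= i u)%N}.
  by apply: ae_forall_nat => k; exact: (@ae_not_first (fun t => k <= i t)%N).
apply: ae_imply => t it t0; have [h h0 hP] := i_right t (ltW t0).
have [w /andP[w0 wt] iw] := it (i t) (ltW t0) (leqnn _).
exists (Num.min h (t - w)); first by rewrite lt_min h0 subr_gt0.
move=> u; rewrite lt_min => /andP[/ltr_normlP[_ u1] /ltr_normlP[u2 _]].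
have wu : w <= u by lra.
have u0 : 0 <= u := le_trans w0 wu.
split => //; have [ut|tu] := leP u t; last by apply: hP; rewrite tu; lra.
apply/eqP; rewrite eqn_leq (i_mono _ _ u0 ut) /=.
exact: leq_trans iw (i_mono _ _ w0 wu).
Qed.

Section solution_abscissa.
Variables (r : 'I_n -> R -> 'I_m) (x : 'I_n -> R -> R).
Hypothesis rx_sol : solution N l V v route `[0, +oo[ r x.
Hypothesis rx_init : forall a, r a 0 = r0 a /\ x a 0 = x0 a.

Definition abscissa_of (a : 'I_n) (t : R) : R :=
  route_abscissa N (route a) (r a t) (x a t).

Let in_time (t : R) : 0 <= t -> t \in `[0, +oo[.
Proof. by move=> t0; rewrite in_itv /= t0. Qed.

Lemma abscissa_of_decode a t : 0 <= t ->
  road_at a (abscissa_of a t) = r a t /\ pos_at a (abscissa_of a t) = x a t.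
Proof.
move=> /in_time tI.
exact: abscissa_decode (sol_road rx_sol a tI) (sol_interval rx_sol a tI).
Qed.

Let idx a t := road_index a (abscissa_of a t).

Let abscissa_of_cont a t : 0 <= t -> forall e, 0 < e -> exists2 h, 0 < h &
  forall u, 0 <= u -> `|u - t| < h -> `|abscissa_of a u - abscissa_of a t| <= e.
Proof. by move: t; apply/within_continuous_dist; exact: (sol_continuous rx_sol). Qed.

Let idx_index a t : 0 <= t -> idx a t = index (r a t) (route a).
Proof. by move=> t0; rewrite -(abscissa_of_decode a t0).1 index_road_at. Qed.

Let idx_mono a s t : 0 <= s -> s <= t -> (idx a s <= idx a t)%N.
Proof.
move=> s0 st; have t0 := le_trans s0 st; rewrite !idx_index //.
by apply: (sol_order rx_sol); rewrite ?in_time.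
Qed.

Let idx_right a t : 0 <= t ->
  exists2 h, 0 < h & forall u, t < u < t + h -> idx a u = idx a t.
Proof.
move=> t0; have [e e0 eP] := road_index_right a (abscissa_of a t).
have e20 : 0 < e / 2 by rewrite divr_gt0.
have [h h0 hP] := abscissa_of_cont a t0 e20.
exists h => // u /andP[tu uth]; have u0 : 0 <= u by lra.
have /ler_normlP[_ Xu] : `|abscissa_of a u - abscissa_of a t| <= e / 2.
  by apply: hP => //; rewrite gtr0_norm ?subr_gt0 //; lra.
apply/eqP; rewrite eqn_leq (idx_mono a t0 (ltW tu)) andbT.
(* The abscissa of a solution is not yet known to be nondecreasing; should it have dropped, the
   index cannot have grown. *)
have [XX|/ltW XX] := leP (abscissa_of a t) (abscissa_of a u).
  by rewrite /idx eP // XX; lra.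
exact: road_index_mono XX.
Qed.

Let same_idx a s t : 0 <= s -> 0 <= t -> idx a s = idx a t ->
  abscissa_of a s - abscissa_of a t = x a s - x a t.
Proof.
move=> s0 t0 st; rewrite -(abscissa_of_decode a s0).2 -(abscissa_of_decode a t0).2.
by rewrite /pos_at -/(idx a s) -/(idx a t) st; lra.
Qed.

Let valid_rx t : 0 <= t -> valid_state N route (r^~ t) (x^~ t).
Proof.
move=> /in_time tI b.
by split; [exact: (sol_road rx_sol)|exact: (sol_interval rx_sol)].
Qed.

Let abscissa_of_ode a : {ae @lebesgue_measure R, forall t, 0 < t ->
  has_slope (abscissa_of a) t (speed N l V v route (r^~ t) (x^~ t) a)}.
Proof.
apply: ae_imply2 (sol_ode rx_sol a) (ae_step_constant (@idx_mono a) (@idx_right a)).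
move=> t xt it t0; have [h h0 hP] := it t0.
apply: (@near_has_slope _ (x a) _ _ _ h) => // [u /hP[u0 iu]|].
  by rewrite (same_idx u0 (ltW t0) iu).
by apply/has_slopeP; apply: xt; rewrite in_time // ltW.
Qed.

Lemma abscissa_of_solution T : abscissa_solution T abscissa_of.
Proof.
split.
- by move=> a; rewrite /abscissa_of (rx_init a).1 (rx_init a).2 x0_abscissa.
- move=> a s t s0 st _.
  have /choice[K KP] : forall j, exists K, 0 <= K /\ forall p q, 0 <= p -> 0 <= q ->
      r a p = j -> r a q = j -> `|x a p - x a q| <= K * `|p - q|.
    move=> j; have /lipschitz_bound[K K0 KP] := sol_lipschitz rx_sol a j.
    by exists K; split => // p q p0 q0 pj qj; apply: KP; split => //; exact: in_time.
  have KS j : K j <= \sum_i K i.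
    by rewrite (bigD1 j) //= lerDl; apply: sumr_ge0 => i _; case: (KP i).
  rewrite -[X in X <= _](mul0r (t - s)).
  (* The sum of the constants of the roads is a crude bound valid just after each time; the almost
     everywhere speeds improve it to [Vmax]. At a change of road only continuity from the left is
     needed. *)
  apply: (ae_slope_bounds (K := \sum_i K i)) => //.
  + by apply: sumr_ge0 => i _; case: (KP i).
  + move=> p /andP[sp pt] e e0; have p0 : 0 <= p by lra.
    have [h h0 hP] := abscissa_of_cont a p0 e0.
    exists h => // u /andP[pu up] su; apply: hP; first exact: le_trans su.
    by rewrite ltr0_norm ?subr_lt0 //; lra.
  + move=> p /andP[sp pt]; have p0 : 0 <= p := le_trans s0 sp.
    have [h h0 hP] := idx_right a p0; exists h => // u pu.
    have /andP[pu' _] := pu; have u0 : 0 <= u by lra.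
    have iu := hP u pu; rewrite (same_idx u0 p0 iu).
    have rup : r a u = r a p.
      rewrite -(abscissa_of_decode a u0).1 -(abscissa_of_decode a p0).1.
      by rewrite /road_at -/(idx a u) iu.
    have [_ /(_ u p u0 p0 rup erefl)] := KP (r a p).
    have up : 0 < u - p by rewrite subr_gt0.
    by rewrite (gtr0_norm up) => /le_trans; apply; rewrite ler_wpM2r // ltW.
  + apply: ae_imply (abscissa_of_ode a) => p Xp /andP[sp pt].
    have p0 : 0 < p by lra.
    exists (speed N l V v route (r^~ p) (x^~ p) a); last exact: Xp.
    have /andP[-> /le_trans] :=
      speed_range l_gt0 v_law route_connects a (valid_rx (ltW p0)).
    by apply.
- apply: ae_imply (ae_forall_fin abscissa_of_ode) => t Xt /andP[t0 _] a.
  have t0' := ltW t0; have := Xt a t0; rewrite /flow.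
  have -> : (fun b => road_at b (abscissa_of b t)) = r^~ t.
    by apply/funext => b; rewrite (abscissa_of_decode b t0').1.
  have -> // : (fun b => pos_at b (abscissa_of b t)) = x^~ t.
  by apply/funext => b; rewrite (abscissa_of_decode b t0').2.
Qed.

End solution_abscissa.

Lemma solution_of_abscissa (X : 'I_n -> R -> R) :
  (forall T, 0 <= T -> abscissa_solution T X) ->
  solution N l V v route `[0, +oo[ (fun a t => road_at a (X a t))
    (fun a t => pos_at a (X a t)).
Proof.
move=> XS.
have in_time (t : R) : (t \in `[0, +oo[) = (0 <= t) by rewrite in_itv /= andbT.
have X_mono a s t : 0 <= s -> s <= t -> X a s <= X a t.
  move=> s0 st; have t0 := le_trans s0 st.
  exact (abscissa_mono (XS t t0) a s0 st (lexx t)).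
have X_norm a s t : 0 <= s -> 0 <= t -> `|X a s - X a t| <= Vmax * `|s - t|.
  move=> s0 t0; case: (leP t s) => [ts|/ltW st].
    rewrite [X in _ <= _ * X]ger0_norm ?subr_ge0 //.
    exact (abscissa_norm a (XS s s0) t0 ts (lexx s)).
  rewrite distrC [`|s - t|]distrC [X in _ <= _ * X]ger0_norm ?subr_ge0 //.
  exact (abscissa_norm a (XS t t0) s0 st (lexx t)).
have X_cont a t : 0 <= t -> forall e, 0 < e -> exists2 h, 0 < h &
    forall u, 0 <= u -> `|u - t| < h -> `|X a u - X a t| <= e.
  move=> t0 e e0; have V10 : 0 < Vmax + 1 by rewrite ltr_wpDl.
  exists (e / (Vmax + 1)); first exact: divr_gt0.
  move=> u u0; rewrite ltr_pdivlMr // => ut; apply: le_trans (X_norm a u t u0 t0) _.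
  by have := normr_ge0 (u - t); lra.
have idx_mono a s t : 0 <= s -> s <= t ->
    (road_index a (X a s) <= road_index a (X a t))%N.
  by move=> s0 st; apply: road_index_mono; exact: X_mono.
have idx_right a t : 0 <= t -> exists2 h, 0 < h & forall u, t < u < t + h ->
    road_index a (X a u) = road_index a (X a t).
  move=> t0; have [e e0 eP] := road_index_right a (X a t).
  have [|h h0 hP] := X_cont a t t0 (e / 2); first by rewrite divr_gt0.
  exists h => // u /andP[tu uth]; apply: eP; rewrite X_mono //=; last exact: ltW.
  have uth' : `|u - t| < h by rewrite gtr0_norm ?subr_gt0 //; lra.
  by have /ler_normlP[_] := hP u (ltW (le_lt_trans t0 tu)) uth'; lra.
have same_idx a s t : road_at a (X a s) = road_at a (X a t) ->
    pos_at a (X a s) - pos_at a (X a t) = X a s - X a t.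
  by move=> st; rewrite /pos_at -!index_road_at st; lra.
split.
- by move=> a t _; exact: road_at_in.
- move=> a t; rewrite in_time => t0; apply: pos_at_interval.
  by apply: (abscissa_ge_init (XS t t0)); rewrite t0 lexx.
- by move=> a s t; rewrite !in_time !index_road_at => s0 _; exact: idx_mono.
- move=> a j; apply/lipschitz_bound; exists Vmax => // s t /= [].
  rewrite in_time => s0 sj [+ tj]; rewrite in_time => t0.
  by rewrite same_idx ?sj ?tj //; exact: X_norm.
- move=> a; have Xode : {ae @lebesgue_measure R, forall t, forall i : nat,
      0 < t < i%:R -> forall a, has_slope (X a) t (flow (X^~ t) a)}.
    by apply: ae_forall_nat => i; exact: abscissa_ode (XS i%:R (ler0n _ _)).
  (* Time [0] and the changes of road are discarded: the derivative is two-sided, and the position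
     may jump when the road changes. *)
  apply: ae_imply2 Xode (ae_imply2 _ (ae_notin_set1 0)
    (ae_step_constant (@idx_mono a) (@idx_right a))); last first.
    move=> t; exact: pair.
  move=> t Xt [t0 it]; rewrite in_time => t_ge0.
  have {t0}t_gt0 : 0 < t by rewrite lt_neqAle eq_sym t0.
  have [h h0 hP] := it t_gt0; apply/has_slopeP.
  apply: (@near_has_slope _ (X a) _ _ _ h) => // [u /hP[u0 iu]|].
    by rewrite same_idx // /road_at iu.
  by apply: (Xt (Num.bound t)); rewrite t_gt0 archi_boundP.
- move=> a j L s t jL; rewrite !in_time => s0 t0 st rj xL.
  have jr : j \in route a by rewrite -(rj s) ?lexx // road_at_in.
  have jn : ~~ is_exit (kind N j).
    by move: jL; rewrite /road_length; case: (kind N j).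
  have LE : L = road_end N j by move: jL; rewrite road_lengthE // => -[].
  set k := index j (route a).
  have kj : nth (r0 a) (route a) k = j by rewrite nth_index.
  have ks : (k.+1 < size (route a))%N.
    have := jr; rewrite -index_mem -/k leq_eqVlt => /predU1P[/route_last_exit|//].
    by rewrite kj => jE; rewrite jE in jn.
  (* Both sides are the left limit of the abscissa at [t]: by its continuity, and because the
     position on [j] tends to [L]. *)
  have XE : X a t = road_start a k.+1.
    rewrite road_startS ?(ltnW ks) // kj -LE.
    apply/eqP; rewrite -subr_eq0 -normr_le0; apply/ler_addgt0Pr => e e0; rewrite add0r.
    have e20 : 0 < e / 2 by rewrite divr_gt0.
    have [h h0 hP] := X_cont a t t0 _ e20.
    have ht : t - h < t by rewrite gtrBl.
    have /cvgrPdist_le /(_ _ e20) xLe := xL.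
    have [u [xu tu su ut]] : exists u, [/\ `|L - pos_at a (X a u)| <= e / 2,
        t - h < u, s < u & u < t].
      near t^'- => u; exists u; split; near: u;
        [exact: xLe|exact: nbhs_left_gt|exact: nbhs_left_gt|exact: nbhs_left_lt].
    have u0 : 0 <= u := le_trans s0 (ltW su).
    have /ler_normlP[Xu1 Xu2] : `|X a u - X a t| <= e / 2.
      by apply: hP => //; rewrite ltr0_norm ?subr_lt0 //; lra.
    have ru : road_at a (X a u) = j by apply: rj; rewrite ut ltW.
    have /ler_normlP[xu1 xu2] := xu; move: xu1 xu2.
    rewrite /pos_at -index_road_at ru -/k => xu1 xu2.
    by apply/ler_normlP; split; lra.
  (* If the next road is not the last, it has positive length, so its start belongs to it and not to
     a later road. *)
  have it : road_index a (X a t) = k.+1.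
    by rewrite XE; apply: road_index_eq => // /road_start_lt.
  rewrite /road_at /pos_at it XE subrr -[in RHS]kj next_road_nth //.
- move=> a; apply/within_continuous_dist => t t0 e e0.
  have [h h0 hP] := X_cont a t t0 e e0; exists h => // u u0 ut.
  by rewrite !route_abscissa_at; exact: hP.
Unshelve. all: by end_near. Qed.

End traffic.

Theorem theorem2p1 (R : realType) (m n : nat) (N : network R m) (l Vmax : R)
  (V : 'I_m -> R) (v : 'I_m -> R -> R)
  (route : 'I_n -> seq 'I_m) (r0 : 'I_n -> 'I_m) (x0 : 'I_n -> R)
  (l_gt0 : 0 < l)
  (l_small : forall j L, kind N j = Middle L -> l < L)
  (has_entry : exists j, kind N j = Entry)
  (has_exit : exists j, kind N j = Exit)
  (V_le : forall j, V j <= Vmax)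
  (v_law : forall j, speed_law (V j) (v j))
  (route_valid : forall a, valid_route N (route a))
  (route_uniq : forall a, uniq (route a))
  (route_first : forall a, ohead (route a) = Some (r0 a))
  (route_last : forall a, kind N (last (r0 a) (route a)) = Exit)
  (x0_road : forall a, x0 a \in road_interval N (r0 a))
  (x0_spaced : forall a b : 'I_n, a != b -> r0 a = r0 b -> l <= `|x0 a - x0 b|) :
  let sol (r : 'I_n -> R -> 'I_m) (x : 'I_n -> R -> R) :=
    solution N l V v route `[0, +oo[ r x /\
    forall a, r a 0 = r0 a /\ x a 0 = x0 a in
  (exists r x, sol r x /\
    forall r' x', sol r' x' ->
      forall (a : 'I_n) (t : R), 0 <= t -> r' a t = r a t /\ x' a t = x a t) /\
  (forall r x, sol r x ->
    forall (t : R) (a b : 'I_n), 0 < t -> a != b -> r a t = r b t ->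
      l <= `|x a t - x b t|).
Proof.
move=> sol.
have Vmax_ge0 : 0 <= Vmax.
  have [j _] := has_entry.
  have /andP[v0 vV] := speed_law_range (v_law j) (lexx 0).
  exact: le_trans v0 (le_trans vV (V_le j)).
split.
  have [X XS] := global_abscissa_solution route_valid route_uniq route_first
    route_last x0_road l_gt0 Vmax_ge0 V_le v_law x0_spaced.
  exists (fun a t => road_at N route r0 a (X a t)), (fun a t => pos_at N route a (X a t)).
  split.
    split; first exact: (solution_of_abscissa route_valid route_uniq route_first
      route_last x0_road Vmax_ge0 XS).
    move=> a; rewrite (abscissa_init (XS 0 (lexx 0))).
    exact: (x0_decode route_valid route_uniq route_first x0_road).
  move=> r x [rx rx0] a t t0.
  have XT := abscissa_of_solution route_valid route_uniq route_first route_last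
    l_gt0 V_le v_law rx rx0 t.
  have tt : 0 <= t <= t by rewrite t0 lexx.
  rewrite -(abscissa_solution_unique route_valid route_uniq route_first
    route_last x0_road l_gt0 Vmax_ge0 V_le v_law x0_spaced XT (XS t t0) tt).
  have [-> ->] := abscissa_of_decode route_valid route_first rx a t0.
  by [].
move=> r x [rx rx0] t a b t0 ab rab.
have XT := abscissa_of_solution route_valid route_uniq route_first route_last
  l_gt0 V_le v_law rx rx0 t.
have tt : 0 <= t <= t by rewrite ltW /=.
have := abscissa_solution_spaced route_valid route_uniq route_first
  route_last x0_road l_gt0 Vmax_ge0 V_le v_law x0_spaced XT tt ab.
have [-> ->] := abscissa_of_decode route_valid route_first rx a (ltW t0).
have [-> ->] := abscissa_of_decode route_valid route_first rx b (ltW t0).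
exact.
Qed.
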